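(* Let $H_L,H_R$ satisfy (H) (see context). Let $\mathcal{G}\subset\mathbb{R}^2$ be a germ for $$\begin{cases} v_t+H_L(v)_x=0, & t>0,\ x<0,\\ v_t+H_R(v)_x=0, & t>0,\ x>0,\\ (v(t,0-),v(t,0+))\in\mathcal{G},& t>0.\end{cases}$$ The following properties are equivalent. (i) There exists a function $F_0$ satisfying (F) such that $\mathcal{G}=\mathcal{G}_{\mathcal{R}F_0}$, where $\mathcal{R}F_0$ is the relaxation of $F_0$ and $\mathcal{G}_{\mathcal{R}F_0}=\{(p_L,p_R)\in\mathbb{R}^2:\ H_L(p_L)=H_R(p_R)=(\mathcal{R}F_0)(p_L,p_R)\}$. (ii) The germ $\mathcal{G}$ is maximal and complete.
   Context: **Assumptions.** (H): for $\alpha\in\{L,R\}$, $H_\alpha:\mathbb{R}\to\mathbb{R}$ is Lipschitz continuous, is not constant on any (nonempty) open interval, and $H_\alpha(p)\to+\infty$ as $|p|\to+\infty$. (F): $F_0:\mathbb{R}^2\to\mathbb{R}$ is Lipschitz continuous, $p_L\mapsto F_0(p_L,p_R)$ is non-decreasing, $p_R\mapsto F_0(p_L,p_R)$ is non-increasing, and $F_0(p_L,p_R)\to+\infty$ as $(p_L)_++(p_R)_-\to+\infty$, where $a_+=\max(0,a)$ and $a_-=\max(0,-a)$. **Relaxation operator.** For $\alpha\in\{L,R\}$, the Godunov flux is $g^{H_\alpha}(p^-,p^+)=\min_{[p^-,p^+]}H_\alpha$ if $p^-\le p^+$ and $g^{H_\alpha}(p^-,p^+)=\max_{[p^+,p^-]}H_\alpha$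 if $p^+\le p^-$. Set $\underline{H}(p_L,p_R)=\max\{H_{L,+}(p_L),H_{R,-}(p_R)\}$ with $H_{L,+}(p_L)=\inf_{q\ge p_L}H_L(q)$ and $H_{R,-}(p_R)=\inf_{q\le p_R}H_R(q)$. If $K:\mathbb{R}^2\to\mathbb{R}$ is continuous, non-decreasing in its first variable, non-increasing in its second variable and satisfies $K\ge\underline{H}$, its Godunov relaxation $KG:\mathbb{R}^2\to\mathbb{R}$ is defined by $(KG)(p_L,p_R)=\lambda$, where $\lambda$ is the (unique) real number for which there exists $(q_L,q_R)\in\mathbb{R}^2$ with $g^{H_L}(p_L,q_L)=K(q_L,q_R)=g^{H_R}(q_R,p_R)=\lambda$. Then $\mathcal{R}F_0:=(\max\{F_0,\underline{H}\})G$. **Germs.** For $\alpha\in\{L,R\}$ let $q_\alpha(a,b)=\mathrm{sgn}(a-b)(H_\alpha(a)-H_\alpha(b))$, and for $P=(p_L,p_R)$, $P'=(p_L',p_R')$ let $D(P,P')=q_L(p_L,p_L')-q_R(p_R,p_R')$. A set $\mathcal{G}\subset\mathbb{R}^2$ is a germ if $H_L(p_L)=H_R(p_R)$ for all $(p_L,p_R)\in\mathcal{G}$ (Rankine-Hugoniot) and $D(P,P')\ge0$ for all $P,P'\in\mathcal{G}$ (dissipation). A germ is maximal if any germ containing it coincides with it. **Entropy solutions.** An essentially bounded $v:(0,T)\times\mathbb{R}\to\mathbb{R}$ has a strong trace at $x=0-$ (resp. $x=0+$) if $x\mapsto v(\cdot,x)\in L^1((0,T))$ has an essential limit in $L^1((0,T))$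 as $x\to0-$ (resp. $x\to0+$); the traces are denoted $v(t,0\mp)$. Such a $v$ having strong traces on both sides is a $\mathcal{G}$-entropy solution with initial data $v_0$ if: it is a classical (Kruzhkov) entropy solution of $v_t+H_L(v)_x=0$ in $(0,T)\times(-\infty,0)$ and of $v_t+H_R(v)_x=0$ in $(0,T)\times(0,+\infty)$; $(v(t,0-),v(t,0+))\in\mathcal{G}$ for almost every $t\in(0,T)$; and $v(t,\cdot)\to v_0$ in $L^1_{\mathrm{loc}}(\mathbb{R})$ as $t\to0+$. On $(0,+\infty)\times\mathbb{R}$ this is required for every $T>0$. **Complete germs.** A germ $\mathcal{G}$ is complete if for all $(v_-,v_+)\in\mathbb{R}^2$ there exists a $\mathcal{G}$-entropy solution on $(0,+\infty)\times\mathbb{R}$ with (Riemann) initial data $v(0,x)=v_-$ if $x<0$ and $v(0,x)=v_+$ if $x>0$. *)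

(* Defs.v *)
From HB Require Import structures.
From mathcomp Require Import all_boot all_order all_algebra.
From mathcomp Require Import all_classical all_reals all_analysis.

Set Implicit Arguments.
Unset Strict Implicit.
Unset Printing Implicit Defensive.

Import Order.TTheory GRing.Theory Num.Theory.
Import numFieldNormedType.Exports.

Local Open Scope classical_set_scope.
Local Open Scope ring_scope.

(* f p tends to +oo as N p tends to +oo. *)
Definition coercive_along {R : realType} {T : Type} (N f : T -> R) : Prop :=
  forall A, exists B, forall p, B <= N p -> A <= f p.

Definition assumption_H {R : realType} (H : R -> R) : Prop :=
  [/\ lipschitz H,
      forall a b c : R, a < b -> ~ {in `]a, b[, forall x, H x = c}
    & coercive_along (fun p : R => `|p|) H].

Definition mixed_monotone {R : realType} (K : R * R -> R) : Prop :=
  (forall pR, {homo (fun pL => K (pL, pR)) : a b / a <= b}) /\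
  (forall pL, {homo (fun pR => K (pL, pR)) : a b / a <= b >-> b <= a}).

Definition assumption_F {R : realType} (F0 : R * R -> R) : Prop :=
  [/\ lipschitz F0,
      mixed_monotone F0
    & coercive_along
        (fun p : R * R => Num.max 0 p.1 + Num.max 0 (- p.2)) F0].

Section relaxation.
Context {R : realType}.
Implicit Types (H HL HR : R -> R) (K : R * R -> R).

(* For continuous H the infimum and the supremum over a compact interval are
   the minimum and the maximum of the usual definition. *)
Definition godunov H (a b : R) : R :=
  if a <= b then inf (H @` `[a, b]) else sup (H @` `[b, a]).

Definition Hunder HL HR (p : R * R) : R :=
  Num.max (inf (HL @` `[p.1, +oo[)) (inf (HR @` `]-oo, p.2])).

(* The value is the chosen element of the set of admissible lambda; this set is
   a singleton when HL and HR satisfy assumption_H and K is continuous, mixed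
   monotone and bounded below by Hunder HL HR. *)
Definition godunov_relax HL HR K (p : R * R) : R :=
  xget 0 [set lam | exists q : R * R,
    [/\ godunov HL p.1 q.1 = lam, K q = lam & godunov HR q.2 p.2 = lam]].

Definition relax HL HR (F0 : R * R -> R) : R * R -> R :=
  godunov_relax HL HR (fun p => Num.max (F0 p) (Hunder HL HR p)).

Definition flux_germ HL HR K : set (R * R) :=
  [set p | HL p.1 = HR p.2 /\ HR p.2 = K p].

End relaxation.

Section germs.
Context {R : realType}.
Implicit Types (H HL HR : R -> R) (G : set (R * R)).

Definition entropy_flux H (a b : R) : R := Num.sg (a - b) * (H a - H b).

Definition dissipation HL HR (P P' : R * R) : R :=
  entropy_flux HL P.1 P'.1 - entropy_flux HR P.2 P'.2.

Definition germ HL HR G : Prop :=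
  (forall P, G P -> HL P.1 = HR P.2) /\
  (forall P P', G P -> G P' -> 0 <= dissipation HL HR P P').

Definition maximal_germ HL HR G : Prop :=
  germ HL HR G /\ forall G', germ HL HR G' -> G `<=` G' -> G' = G.

End germs.

Section entropy_solutions.
Context {R : realType}.

Local Notation mu := (@lebesgue_measure R).
Local Notation mu2 := (mu \x mu)%E.

Implicit Types (H HL HR : R -> R) (G : set (R * R)) (v phi : R * R -> R)
  (g : R -> R) (D : set R) (Om : set (R * R)) (F : set_system R) (T : R).

(* The arguments of v are (t, x). Functions are Borel measurable
   representatives of their almost everywhere equivalence classes. *)
Definition ess_bounded Om v : Prop :=
  measurable_fun Om v /\
  exists M : R, {ae mu2, forall z, Om z -> `|v z| <= M}.

Definition L1_dist D (f g : R -> R) : \bar R :=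
  (\int[mu]_(s in D) (`|f s - g s|)%:E)%E.

(* Essential limit of f along F: the limit after removal of a null set. *)
Definition ess_cvg (f : R -> \bar R) F (l : \bar R) : Prop :=
  exists2 N : set R, mu.-negligible N & f y @[y --> within (~` N) F] --> l.

(* g is the strong trace of v along F, where F is 0^'- or 0^'+. *)
Definition strong_trace T v F g : Prop :=
  mu.-integrable `]0, T[ (EFin \o g) /\
  ess_cvg (fun x => L1_dist `]0, T[ (fun t => v (t, x)) g) F 0%E.

Definition partial_t phi (z : R * R) : R := 'D_((1, 0) : R * R) phi z.
Definition partial_x phi (z : R * R) : R := 'D_((0, 1) : R * R) phi z.

Definition C1 phi : Prop :=
  [/\ forall z, differentiable phi z,
      continuous (partial_t phi) & continuous (partial_x phi)].

Definition test_function Om phi : Prop :=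
  [/\ C1 phi, compact (closure [set z | phi z != 0]),
      closure [set z | phi z != 0] `<=` Om & forall z, 0 <= phi z].

(* Kruzhkov's inequalities |v - k|_t + (sgn (v - k) (H v - H k))_x <= 0 tested
   against nonnegative C1 functions with compact support in the open set Om. *)
Definition kruzhkov_solution H Om v : Prop :=
  forall (k : R) phi, test_function Om phi ->
    (0 <= \int[mu2]_(z in Om)
      (`|v z - k| * partial_t phi z
       + entropy_flux H (v z) k * partial_x phi z)%:E)%E.

(* The limit is essential because v is an almost everywhere class. *)
Definition L1loc_initial_data v (v0 : R -> R) : Prop :=
  forall A : R, ess_cvg (fun t => L1_dist `[- A, A] (fun x => v (t, x)) v0)
    0^'+ 0%E.

Definition entropy_solution_upto HL HR G (v0 : R -> R) T v : Prop :=
  [/\ ess_bounded (`]0, T[ `*` setT) v,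
      exists gm gp, [/\ strong_trace T v 0^'- gm, strong_trace T v 0^'+ gp
        & {ae mu, forall t, t \in `]0, T[ -> G (gm t, gp t)}],
      kruzhkov_solution HL (`]0, T[ `*` `]-oo, 0[) v,
      kruzhkov_solution HR (`]0, T[ `*` `]0, +oo[) v
    & L1loc_initial_data v v0].

Definition entropy_solution HL HR G (v0 : R -> R) v : Prop :=
  forall T, 0 < T -> entropy_solution_upto HL HR G v0 T v.

Definition riemann_data (vm vp x : R) : R := if x < 0 then vm else vp.

Definition complete_germ HL HR G : Prop :=
  germ HL HR G /\
  forall vm vp : R, exists v, entropy_solution HL HR G (riemann_data vm vp) v.

End entropy_solutions.

(* Main.v *)
(* Maximality alone gives (i): the one-sided Lipschitz envelope F0 of the fluxes
   H_L (p_L) over G satisfies F0 = H_L (p_L) on G, because of the dissipation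
   inequalities, so G is contained in the germ of R F0 and equals it.

   Conversely, for v in R^2 take the extremum points closest to v in the
   definition of (R F0)(v). They form a point Q of the germ G of R F0. If v lies
   in a germ containing G, dissipation between v and Q forces the fluxes at v and
   Q to agree, whence v is in G and G is maximal. Moreover Q consists of the
   states at x = 0-, 0+ of the self-similar functions V (x / t), where V xi
   minimizes (or maximizes) H q - xi q between the two states of a Riemann
   problem; these glue to a G-entropy solution.

   For the Kruzhkov inequality, let eta xi = |V xi - k|, psi xi the entropy flux
   and W = psi - xi eta. Then W' <= - eta, and with xi = x / t
     eta phi_t + psi phi_x
       = eta (phi_t + xi phi_x + phi / t) + (W phi_x - eta phi / t).
   After substituting x = t xi, the first term is the t-derivative of
   eta (xi) t phi (t, t xi) and integrates to 0; the second has a nonnegative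
   integral in x for every t. *)
Require Import Defs.
From mathcomp Require Import all_boot all_order all_algebra.
From mathcomp Require Import all_classical all_reals all_analysis.
From mathcomp Require Import measurable_realfun.
From mathcomp Require Import ring lra.

Set Implicit Arguments.
Unset Strict Implicit.
Unset Printing Implicit Defensive.

Import Order.TTheory GRing.Theory Num.Theory.
Import numFieldNormedType.Exports.

Local Open Scope classical_set_scope.
Local Open Scope ring_scope.

(** * The Godunov flux *)

Section lipschitz_functions.
Context {R : realType}.

Lemma lipschitzP (V : normedModType R) (f : V -> R) :
  lipschitz f <->
  exists2 L, 0 <= L & forall x y, `|f x - f y| <= L * `|x - y|.
Proof.
split=> [[M [_ hM]]|[L L0 hL]].
  exists (Num.max 0 (M + 1)); first by rewrite le_max lexx.
  move=> x y; have : M < Num.max 0 (M + 1).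
    by rewrite lt_max [M < M + 1]ltrDl ltr01 orbT.
  by move=> /hM /(_ (x, y)) /=; apply.
exists L; split; first exact: num_real.
move=> M LM [x y] _ /=; apply: le_trans (hL _ _) _.
by rewrite ler_wpM2r// ltW.
Qed.

Lemma lip_continuous (L : R) (H : R -> R) :
  (forall x y, `|H x - H y| <= L * `|x - y|) -> continuous H.
Proof.
move=> hL x; apply/cvgrPdist_le => e e0.
have d0 : 0 < e / (`|L| + 1) by rewrite divr_gt0// ltr_wpDl.
have : \forall y \near x, `|x - y| <= e / (`|L| + 1).
  by apply: (@cvgr_dist_le _ _ _ _ _ id x cvg_id).
apply: filterS => y; rewrite ler_pdivlMr ?ltr_wpDl// => hy.
apply: le_trans (hL _ _) (le_trans _ hy).
by rewrite mulrC ler_wpM2l// (le_trans (ler_norm L))// lerDl.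
Qed.

(** Free of absolute values, this is the form in which linear arithmetic can use the Lipschitz
    bound. *)
Lemma lip_incr (L : R) (H : R -> R) x y :
  (forall x y, `|H x - H y| <= L * `|x - y|) ->
  x <= y -> H x - H y <= L * (y - x) /\ H y - H x <= L * (y - x).
Proof.
move=> hL xy; have := hL x y.
rewrite distrC (distrC x) (ger0_norm (x := y - x)) ?subr_ge0//.
by rewrite ler_norml => /andP[]; split; lra.
Qed.

End lipschitz_functions.

Section godunov_flux.
Context {R : realType}.
Implicit Types (H : R -> R) (a b c v q x : R).

Lemma godunov_minP H a b : continuous H -> a <= b ->
  exists2 c, a <= c <= b &
    H c = godunov H a b /\ forall x, a <= x <= b -> H c <= H x.
Proof.
move=> cH ab; have cH' : {within `[a, b], continuous H}.
  exact: continuous_subspaceT.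
have [c cab hc] := EVT_min ab cH'.
exists c; first by move: cab; rewrite in_itv.
have hc' x : a <= x <= b -> H c <= H x by move=> ?; apply: hc; rewrite in_itv.
split=> //; rewrite /godunov ab; apply/le_anti/andP; split.
  apply: lb_le_inf; first by exists (H c), c.
  by move=> _ [x /= xab <-]; apply: hc.
apply: ge_inf; last by exists c.
by exists (H c) => _ [x /= xab <-]; apply: hc.
Qed.

Lemma godunov_maxP H a b : continuous H -> b <= a ->
  exists2 c, b <= c <= a &
    H c = godunov H a b /\ forall x, b <= x <= a -> H x <= H c.
Proof.
(* For a = b the definition takes the branch of the minimum; over a single point it is also the
   maximum. *)
move=> cH; rewrite le_eqVlt => /predU1P[->|ba].
  have [c cab [hc1 hc2]] := godunov_minP cH (lexx a).
  exists c => //; split=> // x xab.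
  have -> : x = c by apply/le_anti; lra.
  by [].
have cH' : {within `[b, a], continuous H} by exact: continuous_subspaceT.
have [c cab hc] := EVT_max (ltW ba) cH'.
exists c; first by move: cab; rewrite in_itv.
have hc' x : b <= x <= a -> H x <= H c by move=> ?; apply: hc; rewrite in_itv.
split=> //; rewrite /godunov leNgt ba /=; apply/le_anti/andP; split.
  apply: ub_le_sup; last by exists c.
  by exists (H c) => _ [x /= xab <-]; apply: hc.
apply: ge_sup; first by exists (H c), c.
by move=> _ [x /= xab <-]; apply: hc.
Qed.

Lemma godunov_le H a b x : continuous H -> a <= x <= b -> godunov H a b <= H x.
Proof.
move=> cH xab; have ab : a <= b by lra.
by have [c _ [<- hc]] := godunov_minP cH ab; exact: hc.
Qed.

Lemma godunov_ge H a b x : continuous H -> b <= x <= a -> H x <= godunov H a b.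
Proof.
move=> cH xab; have ab : b <= a by lra.
by have [c _ [<- hc]] := godunov_maxP cH ab; exact: hc.
Qed.

Lemma godunovxx H a : continuous H -> godunov H a a = H a.
Proof.
by move=> cH; apply/le_anti; rewrite godunov_le ?godunov_ge// lexx.
Qed.

(** The map x -> -x exchanges the endpoints and turns a <= b into -b <= -a, so a minimum stays a
    minimum. Properties in the second argument are thereby transferred to the first. *)
Lemma godunov_reflect H a b : continuous H ->
  godunov (fun x => H (- x)) (- b) (- a) = godunov H a b.
Proof.
move=> cH; have cH' : continuous (fun x => H (- x)).
  by move=> x; apply: continuous_comp; [exact: continuousN|exact: cH].
have [ab|/ltW ba] := leP a b.
  have [c cab [<- hc]] := godunov_minP cH ab.
  have [|c' cab' [<- hc']] := @godunov_minP _ (- b) (- a) cH'; first lra.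
  apply/le_anti/andP; split; last by apply: hc; lra.
  by have := hc' (- c); rewrite opprK; apply; lra.
have [c cab [<- hc]] := godunov_maxP cH ba.
have [|c' cab' [<- hc']] := @godunov_maxP _ (- b) (- a) cH'; first lra.
apply/le_anti/andP; split; first by apply: hc; lra.
by have := hc' (- c); rewrite opprK; apply; lra.
Qed.

Lemma godunov_nonincr_r H a b b' : continuous H -> b <= b' ->
  godunov H a b' <= godunov H a b.
Proof.
move=> cH bb'; have [ab|/ltW ba] := leP a b.
  have [c cab [<- _]] := godunov_minP cH ab.
  by apply: godunov_le => //; lra.
have [ab'|/ltW ba'] := leP a b'.
  (* Here b <= a <= b', and [H a] separates the minimum over [a, b'] from the maximum over
     [b, a]. *)
  apply: (@le_trans _ _ (H a)).
    by apply: godunov_le => //; lra.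
  by apply: godunov_ge => //; lra.
have [c cab [<- _]] := godunov_maxP cH ba'.
by apply: godunov_ge => //; lra.
Qed.

Lemma reflect_continuous H : continuous H -> continuous (fun x => H (- x)).
Proof.
by move=> cH x; apply: continuous_comp; [exact: continuousN|exact: cH].
Qed.

Lemma godunov_nondecr_l H a a' b : continuous H -> a <= a' ->
  godunov H a b <= godunov H a' b.
Proof.
move=> cH aa'; rewrite -!(godunov_reflect _ _ cH).
by apply: godunov_nonincr_r; [exact: reflect_continuous|lra].
Qed.

(** By monotonicity only the drop from b to a larger b' needs a bound. An extremizer that one of the
    two intervals lacks is replaced by the nearest endpoint of that interval, at distance at most b'
    - b; when a lies between b and b', the two extremizers themselves are that close. *)
Lemma godunov_lip_r (L : R) H a :
  (forall x y, `|H x - H y| <= L * `|x - y|) ->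
  forall x y, `|godunov H a x - godunov H a y| <= L * `|x - y|.
Proof.
move=> hL; have cH := lip_continuous hL.
have L0 : 0 <= L.
  by have := hL 1 0; rewrite subr0 normr1 mulr1; apply: le_trans.
suff W b b' : b <= b' -> godunov H a b - godunov H a b' <= L * (b' - b).
  move=> x y; wlog xy : x y / x <= y.
    move=> wl; have [/wl//|/ltW/wl] := leP x y.
    by rewrite distrC (distrC y).
  rewrite ger0_norm ?subr_ge0 ?godunov_nonincr_r// distrC ger0_norm ?subr_ge0//.
  exact: W.
move=> bb'.
have mono u v : b <= u -> u <= v -> v <= b' -> L * (v - u) <= L * (b' - b).
  by move=> *; apply: ler_wpM2l => //; lra.
have [ab|/ltW ba] := leP a b.
  have [|c cab [<- _]] := @godunov_minP H a b' cH; first lra.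
  have [cb|/ltW bc] := leP c b.
    have : godunov H a b <= H c by apply: godunov_le => //; lra.
    have := mono b b; rewrite subrr mulr0 => /(_ (lexx _) (lexx _) bb'); lra.
  have : godunov H a b <= H b by apply: godunov_le => //; lra.
  have [hm _] := lip_incr hL bc.
  have := mono b c (lexx _) bc; lra.
have [ab'|/ltW ba'] := leP a b'.
  have [c' cab' [<- _]] := godunov_minP cH ab'.
  have [c cab [<- _]] := godunov_maxP cH ba.
  have cc : c <= c' by lra.
  have [hm _] := lip_incr hL cc.
  have := mono c c'; lra.
have [c cab [<- _]] := godunov_maxP cH ba.
have [cb|/ltW bc] := leP b' c.
  have : H c <= godunov H a b' by apply: godunov_ge => //; lra.
  have := mono b b; rewrite subrr mulr0 => /(_ (lexx _) (lexx _) bb'); lra.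
have : H b' <= godunov H a b' by apply: godunov_ge => //; lra.
have [hm _] := lip_incr hL bc.
have := mono c b'; lra.
Qed.

Lemma reflect_lip (L : R) H : (forall x y, `|H x - H y| <= L * `|x - y|) ->
  forall x y, `|H (- x) - H (- y)| <= L * `|x - y|.
Proof. by move=> hL x y; rewrite (le_trans (hL _ _))// -opprD normrN. Qed.

Lemma godunov_lip_l (L : R) H b :
  (forall x y, `|H x - H y| <= L * `|x - y|) ->
  forall x y, `|godunov H x b - godunov H y b| <= L * `|x - y|.
Proof.
move=> hL x y; have cH := lip_continuous hL.
rewrite -!(godunov_reflect _ _ cH).
have := godunov_lip_r (- b) (reflect_lip hL) (- x) (- y).
by rewrite -opprD normrN.
Qed.

(* c is the point closest to v, on its side of v, at which H takes the value
   H c; in particular godunov H v c = H c. *)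
Definition first_hit H v c :=
  (forall x, v <= x < c -> H c < H x) /\ (forall x, c < x <= v -> H x < H c).

Lemma first_hitN H v c :
  first_hit (fun x => - H (- x)) (- v) (- c) <-> first_hit H v c.
Proof.
split=> -[h1 h2]; split=> x hx.
- suff : - H (- - x) < - H (- - c) by rewrite !opprK ltrN2.
  by apply: h2; lra.
- suff : - H (- - c) < - H (- - x) by rewrite !opprK ltrN2.
  by apply: h1; lra.
- by rewrite opprK ltrN2; apply: h2; lra.
- by rewrite opprK ltrN2; apply: h1; lra.
Qed.

Lemma compact_level H a b l : continuous H ->
  compact (`[a, b] `&` [set x | H x = l]).
Proof.
move=> cH; apply: compact_closedI; first exact: segment_compact.
apply: (@closed_comp _ _ H [set l]); last exact: closed_eq.
by move=> x _; exact: cH.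
Qed.

(** The extremizers between v and q form a compact set, and c is its point closest to v. The two
    monotonicities squeeze [godunov H c q] between [godunov H v q] and [godunov H c c], which are
    equal. *)
Lemma godunov_first_hit H v q : continuous H ->
  exists c, [/\ first_hit H v c, H c = godunov H v q
    & godunov H c q = godunov H v q].
Proof.
move=> cH.
have idc (A : set R) : {within A, continuous (@idfun R)}.
  by apply: continuous_subspaceT => x; exact: cvg_id.
have [vq|/ltW qv] := leP v q.
  have [c0 c0vq [hc0 mc0]] := godunov_minP cH vq.
  set l := godunov H v q in hc0 *.
  have S0 : `[v, q] `&` [set x | H x = l] !=set0.
    by exists c0; split => //=; rewrite in_itv.
  have [c] := compact_EVT_min S0 (@compact_level H v q l cH) (idc _).
  rewrite inE /= in_itv /= => -[cvq Hc] cmin.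
  exists c; split=> //.
    split=> x hx; last lra.
    have xvq : v <= x <= q by lra.
    have := mc0 x xvq; rewrite hc0 Hc le_eqVlt => /predU1P[Hx|//].
    suff : c <= x by lra.
    by apply: cmin; rewrite inE /= in_itv.
  apply/le_anti/andP; split.
    by rewrite -Hc -(godunovxx c cH) godunov_nonincr_r//; lra.
  by apply: godunov_nondecr_l => //; lra.
have [c0 c0vq [hc0 mc0]] := godunov_maxP cH qv.
set l := godunov H v q in hc0 *.
have S0 : `[q, v] `&` [set x | H x = l] !=set0.
  by exists c0; split => //=; rewrite in_itv.
have [c] := compact_EVT_max S0 (@compact_level H q v l cH) (idc _).
rewrite inE /= in_itv /= => -[cvq Hc] cmax.
exists c; split=> //.
  split=> x hx; first lra.
  have xvq : q <= x <= v by lra.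
    have := mc0 x xvq; rewrite hc0 Hc le_eqVlt => /predU1P[Hx|//].
  suff : x <= c by lra.
    by apply: cmax; rewrite inE /= in_itv.
apply/le_anti/andP; split.
  by apply: godunov_nondecr_l => //; lra.
by rewrite -Hc -(godunovxx c cH) godunov_nonincr_r//; lra.
Qed.

End godunov_flux.

(** * The relaxation operator *)

Section relaxation_value.
Context {R : realType}.
Implicit Types (H HL HR : R -> R) (K : R * R -> R) (p q : R * R).

Lemma mixed_monotone_le K p q : mixed_monotone K ->
  p.1 <= q.1 -> q.2 <= p.2 -> K p <= K q.
Proof.
case: p q => [p1 p2] [q1 q2] [K1 K2] /= pq1 pq2.
exact: le_trans (K1 p2 _ _ pq1) (K2 q1 _ _ pq2).
Qed.

Lemma lipschitz_left (L : R) K x x' y :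
  (forall p q, `|K p - K q| <= L * `|p - q|) ->
  `|K (x, y) - K (x', y)| <= L * `|x - x'|.
Proof.
move=> hL; apply: le_trans (hL _ _) _.
by rewrite prod_normE /= subrr normr0 max_l.
Qed.

Lemma lipschitz_right (L : R) K x y y' :
  (forall p q, `|K p - K q| <= L * `|p - q|) ->
  `|K (x, y) - K (x, y')| <= L * `|y - y'|.
Proof.
move=> hL; apply: le_trans (hL _ _) _.
by rewrite prod_normE /= subrr normr0 max_r.
Qed.

(* Two one-dimensional intermediate value arguments: K (x, y) = gL x defines,
   for each y, a value mu y which is Lipschitz in y because K is; then
   mu y = gR y is solved for y. *)
Lemma coupled_root K (gL gR : R -> R) :
  assumption_F K -> continuous gL -> continuous gR ->
  (forall x y, x <= y -> gL y <= gL x) ->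
  (forall x y, x <= y -> gR x <= gR y) ->
  (forall A, exists B, forall x, x <= B -> A <= gL x) ->
  (forall A, exists B, forall x, B <= x -> A <= gR x) ->
  exists q, gL q.1 = K q /\ gR q.2 = K q.
Proof.
move=> [/lipschitzP[L L0 hL] mK coK] cL cR mL mR bL bR.
have ex y : exists x, K (x, y) = gL x.
  (* Both sign conditions pass through x = 0: far to the left [gL] exceeds [K (0, y)], far to the
     right K exceeds [gL 0]. *)
  have [B1 hB1] := bL (K (0, y)).
  have [B2 hB2] := coK (gL 0).
  set a := Num.min B1 0; set b := Num.max B2 0.
  have ab : a <= b by apply: (@le_trans _ _ 0); rewrite ?ge_min ?le_max lexx orbT.
  have cf : {within `[a, b], continuous (fun x => K (x, y) - gL x)}.
    apply: continuous_subspaceT => x; apply: cvgB; last exact: cL.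
    exact: (@lip_continuous _ L (fun x => K (x, y)) (fun u v =>
      lipschitz_left u v y hL)).
  have fa : K (a, y) - gL a <= 0.
    rewrite subr_le0; apply: (@le_trans _ _ (K (0, y))).
      by apply: mixed_monotone_le; rewrite //= ge_min lexx orbT.
    by apply: hB1; rewrite ge_min lexx.
  have fb : 0 <= K (b, y) - gL b.
    rewrite subr_ge0; apply: (@le_trans _ _ (gL 0)).
      by apply: mL; rewrite le_max lexx orbT.
    apply: hB2 => /=; apply: (@le_trans _ _ b); first by rewrite le_max lexx.
    by rewrite -[leLHS]addr0 lerD// le_max lexx ?orbT.
  have [|x _ /eqP hx] := IVT ab cf (v := 0).
    by rewrite ge_min le_max fa fb orbT.
  by exists x; apply/eqP; rewrite -subr_eq0.
have [X hX] := choice ex.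
pose mu y := K (X y, y).
have muE y : mu y = gL (X y) by exact: hX.
(* If mu y > mu y', then X y <= X y' because [gL] is non-increasing. Moving the first argument of K
   from X y to X y' only increases K, so the difference is bounded by a variation in y alone. X
   itself need not be continuous. *)
have half y y' : mu y - mu y' <= L * `|y - y'|.
  have [h|h] := leP (mu y) (mu y').
    by rewrite (@le_trans _ _ 0) ?mulr_ge0// subr_le0.
  have XX : X y <= X y'.
    by rewrite leNgt; apply/negP => /ltW /mL; rewrite -!muE leNgt h.
  apply: (@le_trans _ _ (K (X y', y) - K (X y', y'))).
    by rewrite lerB//; apply: mixed_monotone_le.
  exact: le_trans (ler_norm _) (lipschitz_right _ _ _ hL).
have mulip y y' : `|mu y - mu y'| <= L * `|y - y'|.
  rewrite ler_norml half andbT lerNl opprB.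
  by rewrite (le_trans (half _ _))// distrC.
have mumono y y' : y <= y' -> mu y' <= mu y.
  move=> yy'; rewrite leNgt; apply/negP => h.
  have XX : X y' <= X y.
    by rewrite leNgt; apply/negP => /ltW /mL; rewrite -!muE leNgt h.
  have : mu y' <= mu y by apply: mixed_monotone_le.
  by rewrite leNgt h.
have [B1 hB1] := bR (mu 0).
have [B2 hB2] := coK (gR 0).
set a := Num.min (- B2) 0; set b := Num.max B1 0.
have ab : a <= b by apply: (@le_trans _ _ 0); rewrite ?ge_min ?le_max lexx orbT.
have cf : {within `[a, b], continuous (fun y => gR y - mu y)}.
  apply: continuous_subspaceT => x; apply: cvgB; first exact: cR.
  exact: lip_continuous mulip _.
have fa : gR a - mu a <= 0.
  rewrite subr_le0; apply: (@le_trans _ _ (gR 0)).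
    by apply: mR; rewrite ge_min lexx orbT.
  apply: hB2 => /=; apply: (@le_trans _ _ (- a)).
    by rewrite lerNr ge_min lexx.
  by rewrite -[leLHS]add0r lerD// le_max lexx ?orbT.
have fb : 0 <= gR b - mu b.
  rewrite subr_ge0; apply: (@le_trans _ _ (mu 0)).
    by apply: mumono; rewrite le_max lexx orbT.
  by apply: hB1; rewrite le_max lexx.
have [|y _ /eqP hy] := IVT ab cf (v := 0).
  by rewrite ge_min le_max fa fb orbT.
exists (X y, y) => /=; rewrite -/(mu y); split; first by rewrite muE.
by apply/eqP; rewrite -subr_eq0.
Qed.

(** The admissibility relation behind [godunov_relax], isolated so that comparison, existence and
    uniqueness come before any choice of a value. *)
Definition relax_value HL HR K p (lam : R) := exists q,
  [/\ godunov HL p.1 q.1 = lam, K q = lam & godunov HR q.2 p.2 = lam].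

(** If lam > lam', the monotonicity of the Godunov fluxes orders the intermediate states as q.1 <=
    q'.1 and q'.2 <= q.2, so K q <= K q', a contradiction. For p = p' this is the uniqueness of the
    relaxed value. *)
Lemma relax_value_le HL HR K p p' lam lam' :
  continuous HL -> continuous HR -> mixed_monotone K ->
  relax_value HL HR K p lam -> relax_value HL HR K p' lam' ->
  p.1 <= p'.1 -> p'.2 <= p.2 -> lam <= lam'.
Proof.
move=> cL cR mK [q [q1 q2 q3]] [q' [q1' q2' q3']] pp1 pp2.
rewrite leNgt; apply/negP => ll.
have qq1 : q.1 <= q'.1.
  rewrite leNgt; apply/negP => /ltW /(godunov_nonincr_r p.1 cL) h.
  have := godunov_nondecr_l q'.1 cL pp1; rewrite q1'.
  by rewrite q1 in h; lra.
have qq2 : q'.2 <= q.2.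
  rewrite leNgt; apply/negP => /ltW /(godunov_nondecr_l p'.2 cR) h.
  have := godunov_nonincr_r q.2 cR pp2; rewrite q3.
  by rewrite q3' in h; lra.
by have := mixed_monotone_le mK qq1 qq2; rewrite q2 q2' leNgt ll.
Qed.

Lemma relax_value_exists HL HR K p :
  assumption_H HL -> assumption_H HR -> assumption_F K ->
  exists lam, relax_value HL HR K p lam.
Proof.
move=> [/lipschitzP[LL _ hLL] _ coL] [/lipschitzP[LR _ hLR] _ coR] hK.
have cL := lip_continuous hLL; have cR := lip_continuous hLR.
have [||||||q [q1 q2]] := @coupled_root K (godunov HL p.1)
    (fun y => godunov HR y p.2) hK.
- exact: lip_continuous (godunov_lip_r p.1 hLL).
- exact: lip_continuous (godunov_lip_l p.2 hLR).
- by move=> x y; exact: godunov_nonincr_r.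
- by move=> x y; exact: godunov_nondecr_l.
(* For x <= p.1 the flux is a maximum over [x, p.1], hence at least [HL x], and it inherits the
   coercivity of HL. *)
- move=> A; have [B hB] := coL A; exists (Num.min p.1 (- B)) => x.
  rewrite le_min => /andP[x1 x2]; apply: (@le_trans _ _ (HL x)).
    by apply: hB; rewrite -normrN (le_trans _ (ler_norm (- x)))// lerNr.
  by apply: godunov_ge => //; rewrite lexx ?andbT.
- move=> A; have [B hB] := coR A; exists (Num.max p.2 B) => x.
  rewrite ge_max => /andP[x1 x2]; apply: (@le_trans _ _ (HR x)).
    by apply: hB; rewrite (le_trans _ (ler_norm x)).
  by apply: godunov_ge => //; rewrite lexx ?andbT.
by exists (K q), q.
Qed.

Lemma godunov_relaxP HL HR K p :
  assumption_H HL -> assumption_H HR -> assumption_F K ->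
  forall lam, relax_value HL HR K p lam <-> godunov_relax HL HR K p = lam.
Proof.
move=> hL hR hK.
have [/lipschitzP[LL _ hLL] _ coL] := hL.
have [/lipschitzP[LR _ hLR] _ coR] := hR.
have cL := lip_continuous hLL; have cR := lip_continuous hLR.
have [_ mK _] := hK.
have h : relax_value HL HR K p (godunov_relax HL HR K p).
  have [lam hlam] := relax_value_exists p hL hR hK.
  exact: (@xgetPex _ 0 [set lam | relax_value HL HR K p lam]) (ex_intro _ lam hlam).
move=> lam; split=> [hlam|<-//].
by apply/le_anti/andP; split; apply: (relax_value_le cL cR mK (p := p) (p' := p)).
Qed.

End relaxation_value.

(** * Tail infima of a flux *)

Section tail_infimum.
Context {R : realType}.
Implicit Types (H : R -> R).

(** This is H_{L,+}; applied to the reflected right flux it also yields H_{R,-}, so one theory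
    serves both sides. *)
Definition tail_inf H p := inf (H @` `[p, +oo[).

Lemma left_tail_inf H p :
  inf (H @` `]-oo, p]) = tail_inf (fun x => H (- x)) (- p).
Proof.
rewrite /tail_inf; congr inf; apply/seteqP; split=> _ [x /= xp <-].
  by exists (- x); rewrite ?opprK//= in_itv/= andbT lerN2; move: xp; rewrite in_itv.
by exists (- x) => //=; rewrite in_itv/= lerNl; move: xp; rewrite in_itv/= andbT.
Qed.

(** Coercivity handles large |x| and the Lipschitz bound the rest. It makes the infima in [Hunder]
    genuine. *)
Lemma coercive_has_lbound (L : R) H :
  (forall x y, `|H x - H y| <= L * `|x - y|) ->
  coercive_along (fun p : R => `|p|) H -> exists m, forall x, m <= H x.
Proof.
move=> hL coH; have [B hB] := coH 0.
exists (Num.min 0 (H 0 - `|L| * `|B|)) => x; rewrite ge_min.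
have [/hB->//|xB] := leP B `|x|; apply/orP; right.
have := hL x 0; rewrite subr0 ler_norml => /andP[h _].
have : L * `|x| <= `|L| * `|B|.
  apply: (@le_trans _ _ (`|L| * `|x|)); first by rewrite ler_wpM2r// ler_norm.
  by rewrite ler_wpM2l// (le_trans (ltW xB))// ler_norm.
lra.
Qed.

Section bounded_below.
Variables (L m : R) (H : R -> R).
Hypothesis hL : forall x y, `|H x - H y| <= L * `|x - y|.
Hypothesis hm : forall x, m <= H x.

Lemma tail_inf_le p x : p <= x -> tail_inf H p <= H x.
Proof.
move=> px; apply: ge_inf; first by exists m => _ [y _ <-].
by exists x => //=; rewrite in_itv/= px.
Qed.

Lemma tail_inf_ge p A : (forall x, p <= x -> A <= H x) -> A <= tail_inf H p.
Proof.
move=> hA; apply: lb_le_inf.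
  by exists (H p), p => //=; rewrite in_itv/= lexx.
by move=> _ [y /= +] <-; rewrite in_itv/= andbT; exact: hA.
Qed.

Lemma tail_inf_nondecr p p' : p <= p' -> tail_inf H p <= tail_inf H p'.
Proof.
by move=> pp'; apply: tail_inf_ge => x p'x; apply: tail_inf_le; lra.
Qed.

(** A point x of [p, p'], lost when the tail shrinks, is replaced by p', which costs at most L * (p'
    - x). *)
Lemma tail_inf_lip p p' : `|tail_inf H p - tail_inf H p'| <= L * `|p - p'|.
Proof.
wlog pp' : p p' / p <= p'.
  move=> wl; have [/wl//|/ltW/wl] := leP p p'.
  by rewrite distrC (distrC p').
rewrite distrC ger0_norm ?subr_ge0 ?tail_inf_nondecr//.
rewrite distrC ger0_norm ?subr_ge0// lerBlDl -lerBlDr.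
have L0 : 0 <= L.
  by have := hL 1 0; rewrite subr0 normr1 mulr1; apply: le_trans.
apply: tail_inf_ge => x px; have [p'x|/ltW xp'] := leP p' x.
  have := tail_inf_le p'x.
  have : 0 <= L * (p' - p) by rewrite mulr_ge0// subr_ge0.
  lra.
have := tail_inf_le (lexx p').
have [_ h] := lip_incr hL xp'.
have : L * (p' - x) <= L * (p' - p) by rewrite ler_wpM2l//; lra.
lra.
Qed.

End bounded_below.
End tail_infimum.

Section flux_functions.
Context {R : realType}.
Implicit Types (H HL HR : R -> R) (K F : R * R -> R) (p q : R * R).

Lemma dist_max_le (a b c d e : R) : `|a - c| <= e -> `|b - d| <= e ->
  `|Num.max a b - Num.max c d| <= e.
Proof.
rewrite !ler_norml => /andP[? ?] /andP[? ?].
by case: (leP a b) => ?; case: (leP c d) => ?; apply/andP; split; lra.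
Qed.

Lemma lipschitz_max (V : normedModType R) (f g : V -> R) :
  lipschitz f -> lipschitz g -> lipschitz (fun x => Num.max (f x) (g x)).
Proof.
move=> /lipschitzP[L1 L10 h1] /lipschitzP[L2 L20 h2]; apply/lipschitzP.
exists (Num.max L1 L2) => [|x y]; first by rewrite le_max L10.
apply: dist_max_le; [apply: le_trans (h1 x y) _|apply: le_trans (h2 x y) _];
  by rewrite ler_wpM2r// le_max lexx ?orbT.
Qed.

Lemma mixed_monotone_max F K : mixed_monotone F -> mixed_monotone K ->
  mixed_monotone (fun p => Num.max (F p) (K p)).
Proof.
move=> mF mK.
have h p q : p.1 <= q.1 -> q.2 <= p.2 ->
    Num.max (F p) (K p) <= Num.max (F q) (K q).
  move=> pq1 pq2; rewrite ge_max !le_max.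
  by rewrite (mixed_monotone_le mF pq1 pq2) (mixed_monotone_le mK pq1 pq2) orbT.
by split=> [y a b ab|x a b ab]; exact: h.
Qed.

Lemma lipschitz_fst f : @lipschitz_on R R R f (globally (setT `*` setT)) ->
  lipschitz (fun p : R * R => f p.1).
Proof.
move=> /lipschitzP[L L0 h]; apply/lipschitzP; exists L => // x y.
by apply: le_trans (h _ _) _; rewrite ler_wpM2l// prod_normE/= le_max lexx.
Qed.

Lemma lipschitz_snd f : @lipschitz_on R R R f (globally (setT `*` setT)) ->
  lipschitz (fun p : R * R => f p.2).
Proof.
move=> /lipschitzP[L L0 h]; apply/lipschitzP; exists L => // x y.
by apply: le_trans (h _ _) _; rewrite ler_wpM2l// prod_normE/= le_max lexx orbT.
Qed.

(** Through the maximum with [Hunder], every Lipschitz mixed monotone function becomes coercive and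
    so satisfies (F). *)
Lemma assumption_F_Hunder HL HR : assumption_H HL -> assumption_H HR ->
  assumption_F (Hunder HL HR).
Proof.
move=> [/lipschitzP[LL LL0 hL] _ coL] [/lipschitzP[LR LR0 hR] _ coR].
have [mL bL] := coercive_has_lbound hL coL.
have [mR bR] := coercive_has_lbound hR coR.
have bR' x : mR <= HR (- x) by [].
have -> : Hunder HL HR = (fun p =>
    Num.max (tail_inf HL p.1) (tail_inf (fun x => HR (- x)) (- p.2))).
  by apply/funext => p; rewrite /Hunder left_tail_inf.
have hRl := tail_inf_lip (reflect_lip hR) bR'.
split.
- apply: lipschitz_max; [apply: lipschitz_fst|
    apply: (@lipschitz_snd (fun x => tail_inf (fun x => HR (- x)) (- x)))];
    apply/lipschitzP.
    by exists LL => //; exact: tail_inf_lip hL bL.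
  by exists LR => // x y; rewrite (le_trans (hRl _ _))// -opprD normrN.
- apply: mixed_monotone_max; split=> y a b ab //=.
    exact: tail_inf_nondecr bL _ _ ab.
  by apply: (tail_inf_nondecr bR'); rewrite lerN2.
- move=> A; have [B1 h1] := coL A; have [B2 h2] := coR A.
  (* If x and -y were both below B, the sum of their positive parts would be at most 2B. *)
  exists (2 * Num.max 0 (Num.max B1 B2) + 1) => -[x y] /= h.
  set B := Num.max 0 (Num.max B1 B2) in h.
  have [B0 B1B B2B] : [/\ 0 <= B, B1 <= B & B2 <= B] by rewrite !le_max !lexx !orbT.
  have [hx|hx] : B <= x \/ B <= - y.
    move: h; rewrite !maxEle; case: ifP => _; case: ifP => _ h; lra.
  - rewrite le_max tail_inf_ge// => u xu.
    by apply: h1; rewrite (le_trans _ (ler_norm _))//; lra.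
  - rewrite le_max [X in _ || X]tail_inf_ge ?orbT// => u xu.
    by apply: h2; rewrite normrN (le_trans _ (ler_norm _))//; lra.
Qed.

Lemma assumption_F_max F K : lipschitz F -> mixed_monotone F ->
  assumption_F K -> assumption_F (fun p => Num.max (F p) (K p)).
Proof.
move=> lF mF [lK mK coK]; split.
- exact: lipschitz_max.
- exact: mixed_monotone_max.
- move=> A; have [B hB] := coK A; exists B => p /hB hp.
  by rewrite le_max hp orbT.
Qed.

Lemma relaxP HL HR F p lam :
  assumption_H HL -> assumption_H HR -> assumption_F F ->
  relax_value HL HR (fun p => Num.max (F p) (Hunder HL HR p)) p lam
  <-> relax HL HR F p = lam.
Proof.
move=> hL hR [lF mF coF]; apply: godunov_relaxP => //.
by apply: assumption_F_max => //; exact: assumption_F_Hunder.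
Qed.

(** Each tail infimum is at most the flux at its own endpoint. Hence at points with equal fluxes the
    maximum with [Hunder] does not raise a value equal to that flux. *)
Lemma Hunder_le HL HR x y lam : assumption_H HL -> assumption_H HR ->
  HL x = lam -> HR y = lam -> Hunder HL HR (x, y) <= lam.
Proof.
move=> [/lipschitzP[LL _ hL] _ coL] [/lipschitzP[LR _ hR] _ coR] hx hy.
have [mL bL] := coercive_has_lbound hL coL.
have [mR bR] := coercive_has_lbound hR coR.
have bR' u : mR <= HR (- u) by [].
rewrite /Hunder left_tail_inf ge_max /=; apply/andP; split.
  by rewrite -hx; exact: tail_inf_le bL _ _ _.
by rewrite -hy -[y in leRHS]opprK; exact: (tail_inf_le bR' (lexx _)).
Qed.

End flux_functions.

(** * Germs *)

Section flux_germs.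
Context {R : realType}.
Implicit Types (H HL HR : R -> R) (F : R * R -> R) (P Q : R * R)
  (G : set (R * R)).

(** Rankine-Hugoniot makes both flux differences equal, so the dissipation is the difference of two
    signs times that common factor. Its sign becomes an order condition: a larger flux needs a
    larger left state or a smaller right state. *)
Lemma dissipation_ge0P HL HR P P' : HL P.1 = HR P.2 -> HL P'.1 = HR P'.2 ->
  (0 <= dissipation HL HR P P') <->
  (HL P'.1 < HL P.1 -> P'.1 < P.1 \/ P.2 < P'.2) /\
  (HL P.1 < HL P'.1 -> P.1 < P'.1 \/ P'.2 < P.2).
Proof.
case: P P' => [p r] [p' r'] /= e e'.
rewrite /dissipation /entropy_flux /= -e -e' -mulrBl.
have [ll|ll|ll] := ltgtP (HL p) (HL p'); last first.
- by rewrite ll subrr mulr0 lexx; split.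
- rewrite pmulr_lge0 ?subr_gt0//.
  have [pp|pp|pp] := ltgtP p p'; last by rewrite pp ltxx in ll.
    rewrite ltr0_sg ?subr_lt0//.
    have [rr|rr|rr] := ltgtP r r'; last by rewrite e e' rr ltxx in ll.
    + by rewrite ltr0_sg ?subr_lt0// subrr lexx; split=> // _; split=> // _; right.
    + rewrite gtr0_sg ?subr_gt0//; split; first lra.
      by move=> [/(_ isT)[|]].
  rewrite (gtr0_sg (x := p - p')) ?subr_gt0//; split=> [_|_].
    by split=> // _; left.
  by rewrite subr_ge0; case: sgrP => _; lra.
- rewrite nmulr_lge0 ?subr_lt0//.
  have [pp|pp|pp] := ltgtP p p'; last by rewrite pp ltxx in ll.
    rewrite (ltr0_sg (x := p - p')) ?subr_lt0//; split=> [_|_].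
      by split=> // _; left.
    by rewrite subr_le0; case: sgrP => _; lra.
  rewrite gtr0_sg ?subr_gt0//.
  have [rr|rr|rr] := ltgtP r r'; last by rewrite e e' rr ltxx in ll.
  + rewrite ltr0_sg ?subr_lt0//; split; first lra.
    by move=> [_ /(_ isT)[|]].
  + by rewrite gtr0_sg ?subr_gt0// subrr lexx; split=> // _; split=> // _; right.
Qed.

(** When both alternatives of the order condition fail, [relax_value_le] reverses the strict
    inequality between the fluxes. *)
Lemma germ_flux_germ_relax HL HR F :
  assumption_H HL -> assumption_H HR -> assumption_F F ->
  germ HL HR (flux_germ HL HR (relax HL HR F)).
Proof.
move=> hL hR hF.
have [/lipschitzP[LL _ /lip_continuous cL] _ _] := hL.
have [/lipschitzP[LR _ /lip_continuous cR] _ _] := hR.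
have [lF mF _] := hF.
have mK : mixed_monotone (fun p => Num.max (F p) (Hunder HL HR p)).
  by apply: mixed_monotone_max => //; case: (assumption_F_Hunder hL hR).
split=> [P []//|P P' [e1 e2] [e1' e2']].
have mono Q Q' : HL Q.1 = relax HL HR F Q -> HL Q'.1 = relax HL HR F Q' ->
    HL Q'.1 < HL Q.1 -> Q'.1 < Q.1 \/ Q.2 < Q'.2.
  move=> eQ eQ' lt.
  have [|h1] := ltP Q'.1 Q.1; first by left.
  have [|h2] := ltP Q.2 Q'.2; first by right.
  have r : forall P, HL P.1 = relax HL HR F P ->
      relax_value HL HR (fun p => Num.max (F p) (Hunder HL HR p)) P (HL P.1).
    by move=> ? eP; apply/relaxP.
  by have := relax_value_le cL cR mK (r _ eQ) (r _ eQ') h1 h2; rewrite leNgt lt.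
apply/dissipation_ge0P => //; split=> lt.
  by apply: mono => //; congruence.
by apply: mono => //; congruence.
Qed.

(** A McShane extension of the flux from G for an asymmetric distance: it penalizes only a decrease
    of the left state or an increase of the right state, the directions in which a mixed monotone
    function may decrease. *)
Definition germ_flux (L : R) HL G P : R :=
  sup [set HL P'.1 - L * Num.max 0 (P'.1 - P.1) - L * Num.max 0 (P.2 - P'.2)
      | P' in G].

Section germ_flux_theory.
Variables (L : R) (HL HR : R -> R) (G : set (R * R)).
Hypothesis L0 : 0 <= L.
Hypothesis hL : forall x y, `|HL x - HL y| <= L * `|x - y|.
Hypothesis hR : forall x y, `|HR x - HR y| <= L * `|x - y|.
Hypothesis gG : germ HL HR G.
Variable P0 : R * R.
Hypothesis GP0 : G P0.

Let f P P' := HL P'.1 - L * Num.max 0 (P'.1 - P.1) - L * Num.max 0 (P.2 - P'.2).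

(** Triangle inequality for the asymmetric distance. *)
Let f_le P P' Q :
  f P P' <= f Q P' + L * Num.max 0 (P.1 - Q.1) + L * Num.max 0 (Q.2 - P.2).
Proof.
rewrite /f.
have h (a b c : R) :
    L * Num.max 0 (a - b) <= L * Num.max 0 (a - c) + L * Num.max 0 (c - b).
  rewrite -mulrDr ler_wpM2l//.
  by case: (leP 0 (a - b)); case: (leP 0 (a - c)); case: (leP 0 (c - b)); lra.
have := h P'.1 Q.1 P.1; have := h Q.2 P'.2 P.2; lra.
Qed.

(** If the flux at P' is the larger one, dissipation says that P.1 < P'.1 or P'.2 < P.2. The
    Lipschitz bound of the flux on that side shows that the corresponding penalty covers the
    excess. *)
Let f_germ P P' : G P -> G P' -> f P P' <= HL P.1.
Proof.
move=> GP GP'; rewrite /f.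
have m0 (x : R) : 0 <= L * Num.max 0 x by rewrite mulr_ge0// le_max lexx.
have mx (x : R) : L * x <= L * Num.max 0 x by rewrite ler_wpM2l// le_max lexx orbT.
have [ll|ll] := leP (HL P'.1) (HL P.1).
  by have := m0 (P'.1 - P.1); have := m0 (P.2 - P'.2); lra.
have [rh dis] := gG.
have /(dissipation_ge0P (rh _ GP) (rh _ GP'))[_ /(_ ll)[h|h]] := dis _ _ GP GP'.
  have [_ h1] := lip_incr hL (ltW h).
  by have := mx (P'.1 - P.1); have := m0 (P.2 - P'.2); lra.
have [h1 _] := lip_incr hR (ltW h); rewrite (rh _ GP) (rh _ GP').
rewrite (rh _ GP) (rh _ GP') in ll.
by have := mx (P.2 - P'.2); have := m0 (P'.1 - P.1); lra.
Qed.

Let f_ub P : has_ubound [set f P P' | P' in G].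
Proof.
exists (HL P0.1 + L * Num.max 0 (P.1 - P0.1) + L * Num.max 0 (P0.2 - P.2)).
move=> _ [P' GP' <-].
by apply: le_trans (f_le P P' P0) _; have := f_germ GP0 GP'; lra.
Qed.

Lemma germ_flux_le P Q : germ_flux L HL G P <=
  germ_flux L HL G Q + L * Num.max 0 (P.1 - Q.1) + L * Num.max 0 (Q.2 - P.2).
Proof.
apply: ge_sup; first by exists (f P P0), P0.
move=> _ [P' GP' <-]; apply: le_trans (f_le P P' Q) _; rewrite !lerD2r.
by apply: ub_le_sup; [exact: f_ub|exists P'].
Qed.

Lemma germ_fluxE P : G P -> germ_flux L HL G P = HL P.1.
Proof.
move=> GP; apply/le_anti/andP; split.
  apply: ge_sup; first by exists (f P P0), P0.
  by move=> _ [P' GP' <-]; exact: f_germ.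
apply: ub_le_sup; first exact: f_ub.
by exists P => //; rewrite !subrr max_l// mulr0 !subr0.
Qed.

Lemma germ_flux_mixed_monotone : mixed_monotone (germ_flux L HL G).
Proof.
split=> [y a b ab|x a b ab] /=.
  apply: le_trans (germ_flux_le (a, y) (b, y)) _ => /=.
  by rewrite subrr maxxx mulr0 addr0 max_l ?subr_le0// mulr0 addr0.
apply: le_trans (germ_flux_le (x, b) (x, a)) _ => /=.
by rewrite subrr maxxx mulr0 addr0 max_l ?subr_le0// mulr0 addr0.
Qed.

Lemma germ_flux_lipschitz : lipschitz (germ_flux L HL G).
Proof.
apply/lipschitzP; exists (L + L) => [|P Q]; first by rewrite addr_ge0.
have h (x : R) y : x <= y -> 0 <= y -> L * Num.max 0 x <= L * y.
  by move=> xy y0; rewrite ler_wpM2l// ge_max y0.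
have [n1 n2] : `|P.1 - Q.1| <= `|P - Q| /\ `|P.2 - Q.2| <= `|P - Q|.
  by rewrite prod_normE /= !le_max !lexx orbT.
have d1 : P.1 - Q.1 <= `|P - Q| by rewrite (le_trans (ler_norm _)).
have d2 : P.2 - Q.2 <= `|P - Q| by rewrite (le_trans (ler_norm _)).
have d3 : Q.1 - P.1 <= `|P - Q| by rewrite (le_trans (ler_norm _))// distrC.
have d4 : Q.2 - P.2 <= `|P - Q| by rewrite (le_trans (ler_norm _))// distrC.
have := germ_flux_le P Q; have := germ_flux_le Q P.
have := h _ _ d1 (normr_ge0 _); have := h _ _ d2 (normr_ge0 _).
have := h _ _ d3 (normr_ge0 _); have := h _ _ d4 (normr_ge0 _).
rewrite mulrDl => *; rewrite ler_norml; apply/andP; split; lra.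
Qed.

End germ_flux_theory.

Lemma maximal_germ_relax HL HR G : assumption_H HL -> assumption_H HR ->
  maximal_germ HL HR G ->
  exists F, assumption_F F /\ G = flux_germ HL HR (relax HL HR F).
Proof.
move=> hL hR [gG maxG].
have [/lipschitzP[LL LL0 lL] _ _] := hL.
have [/lipschitzP[LR LR0 lR] _ _] := hR.
have [cL cR] := (lip_continuous lL, lip_continuous lR).
have hU := assumption_F_Hunder hL hR.
suff [F hF sF] : exists2 F, assumption_F F &
    G `<=` flux_germ HL HR (relax HL HR F).
  by exists F; split=> //; rewrite (maxG _ _ sF)//; exact: germ_flux_germ_relax.
(* The supremum in [germ_flux] is meaningless over an empty germ; there the inclusion is trivial and
   any F satisfying (F) will do. *)
have [G0|/set0P[P0 GP0]] := eqVneq G set0.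
  by exists (Hunder HL HR) => //; rewrite G0; exact: sub0set.
pose L := Num.max LL LR.
have L0 : 0 <= L by rewrite le_max LL0.
have lL' x y : `|HL x - HL y| <= L * `|x - y|.
  by apply: le_trans (lL _ _) _; rewrite ler_wpM2r// le_max lexx.
have lR' x y : `|HR x - HR y| <= L * `|x - y|.
  by apply: le_trans (lR _ _) _; rewrite ler_wpM2r// le_max lexx orbT.
exists (fun p => Num.max (germ_flux L HL G p) (Hunder HL HR p)).
  apply: assumption_F_max => //; first exact: (germ_flux_lipschitz L0 lL' lR' gG GP0).
  exact: (germ_flux_mixed_monotone L0 lL' lR' gG GP0).
move=> P GP; have rhP := gG.1 P GP; split=> //=; apply/esym.
apply/relaxP => //.
  apply: assumption_F_max => //; first exact: (germ_flux_lipschitz L0 lL' lR' gG GP0).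
  exact: (germ_flux_mixed_monotone L0 lL' lR' gG GP0).
(* P is its own intermediate state, since the Godunov flux on the diagonal is the flux. [Hunder]
   then occurs twice, once from F and once from the relaxation. *)
exists P; split; [by rewrite godunovxx| |by rewrite godunovxx].
rewrite (germ_fluxE L0 lL' lR' gG GP0 GP) -maxA maxxx max_l//.
by rewrite [P in leLHS]surjective_pairing rhP; exact: Hunder_le.
Qed.

(* The states of a self-similar solution with Riemann data P at x = 0-, 0+. *)
Lemma relax_riemann_traces HL HR F P :
  assumption_H HL -> assumption_H HR -> assumption_F F ->
  exists Q, [/\ flux_germ HL HR (relax HL HR F) Q,
    relax HL HR F Q = relax HL HR F P, first_hit HL P.1 Q.1
    & first_hit (fun x => HR (- x)) (- P.2) (- Q.2)].
Proof.
move=> hL hR hF.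
have [/lipschitzP[LL _ /lip_continuous cL] _ _] := hL.
have [/lipschitzP[LR _ /lip_continuous cR] _ _] := hR.
have cR' := reflect_continuous cR.
have [q [q1 q2 q3]] := (relaxP _ _ hL hR hF).2 (erefl (relax HL HR F P)).
have [a [a1 a2 a3]] := godunov_first_hit P.1 q.1 cL.
have [b [b1 b2 b3]] := godunov_first_hit (- P.2) (- q.2) cR'.
rewrite (godunov_reflect _ _ cR) in b2 b3.
(* The intermediate state q of P also serves (a, -b), because the fluxes towards q are unchanged. *)
have e : relax HL HR F (a, - b) = relax HL HR F P.
  apply/relaxP => //; exists q; split=> //=; first by rewrite a3.
  by rewrite -(godunov_reflect _ _ cR) opprK b3.
exists (a, - b); rewrite /= opprK; split=> //.
by rewrite /flux_germ /= e a2 b2 q1 q3.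
Qed.

Lemma maximal_flux_germ_relax HL HR F :
  assumption_H HL -> assumption_H HR -> assumption_F F ->
  maximal_germ HL HR (flux_germ HL HR (relax HL HR F)).
Proof.
move=> hL hR hF; have gG := germ_flux_germ_relax hL hR hF; split=> // G' [rh dis] GG'.
apply/seteqP; split=> // P GP.
have [Q [GQ eQ [h1 h1'] [h2 h2']]] := relax_riemann_traces P hL hR hF.
have rP := rh _ GP; have rQ := rh _ (GG' _ GQ).
have := dis _ _ GP (GG' _ GQ).
move=> /(dissipation_ge0P rP rQ)[d1 d2].
suff e : HL P.1 = HL Q.1.
  case: GQ => /= e1 e2; split=> //.
  by rewrite -eQ -e2 -e1 -rP.
(* For unequal fluxes, each alternative of the order condition places the state of P strictly on the
   wrong side of that of Q; the first-hit property, evaluated at the state of P itself, contradicts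
   this. *)
apply/le_anti; rewrite !leNgt; apply/andP; split; apply/negP => lt.
  have [h|h] := d1 lt.
    by have := h1' P.1; rewrite lexx h ltNge (ltW lt) => /(_ isT).
  have := h2' (- P.2); rewrite lexx ltrN2 h /= !opprK => /(_ isT).
  by rewrite -rP -rQ ltNge (ltW lt).
have [h|h] := d2 lt.
  by have := h1 P.1; rewrite lexx h ltNge (ltW lt) => /(_ isT).
have := h2 (- P.2); rewrite lexx ltrN2 h /= !opprK => /(_ isT).
by rewrite -rP -rQ ltNge (ltW lt).
Qed.

End flux_germs.

(** * Integration tools *)

Section measure_tools.
Context {R : realType}.
Local Notation mu := (@lebesgue_measure R).

Lemma measurable_invr : measurable_fun [set: R] (@GRing.inv R).
Proof.
have -> : [set: R] = [set 0] `|` ~` [set 0].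
  by rewrite setUCr.
have m0 : measurable [set (0 : R)] by exact: measurable_set1.
have m0c : measurable (~` [set (0 : R)]) by exact: measurableC.
apply/measurable_funU => //; split; first exact: measurable_fun_set1.
apply: open_continuous_measurable_fun; first exact/closed_openC/closed_eq.
by move=> x; rewrite inE /= => /eqP x0; exact: inv_continuous.
Qed.

(** An open set is the union of the countably many rational boxes that it contains, and boxes are
    measurable rectangles. *)
Lemma open_measurable_prod (U : set (R * R)) : open U -> measurable U.
Proof.
move=> oU.
pose box (i : (rat * rat) * (rat * rat)) : set (R * R) :=
  `]ratr i.1.1, ratr i.1.2[ `*` `]ratr i.2.1, ratr i.2.2[.
have -> : U = \bigcup_i (if `[< box i `<=` U >] then box i else set0).
  apply/seteqP; split=> [z Uz|z [i _]]; last by case: asboolP => // h zb; exact: h.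
  have /nbhs_ballP[e /= e0 he] := open_nbhs_nbhs (conj oU Uz).
  have lt (x : R) : x - e < x /\ x < x + e by rewrite ltrDl gtrDl oppr_lt0 e0.
  have [a] := rat_in_itvoo (lt z.1).1; have [b] := rat_in_itvoo (lt z.1).2.
  have [c] := rat_in_itvoo (lt z.2).1; have [d] := rat_in_itvoo (lt z.2).2.
  rewrite !in_itv /= => /andP[d1 d2] /andP[c1 c2] /andP[b1 b2] /andP[a1 a2].
  exists ((a, b), (c, d)) => //; case: asboolP => [_|]; last first.
    case=> w [] /=; rewrite !in_itv /= => /andP[w1 w2] /andP[w3 w4]; apply: he.
    by split; rewrite /= /ball /= ltr_norml; apply/andP; split; lra.
  by split; rewrite /= in_itv /=; apply/andP.
apply: countable_bigcupT_measurable => [|i]; first exact: countableP.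
by case: asboolP => // _; apply: measurableX; exact: measurable_itv.
Qed.

Lemma continuous_measurable_prod (f : R * R -> R) :
  continuous f -> measurable_fun setT f.
Proof.
move=> cf; apply: (measurability (@RGenOInfty.G R)) => [|/= _ [_] [r] -> <-].
  exact: RGenOInfty.measurableE.
rewrite setTI; apply: open_measurable_prod.
by apply: open_comp => [z _|]; [exact: cf|exact: interval_open].
Qed.

Section bounded_support.
Context d (T : measurableType d) (m : {measure set T -> \bar R}).

Lemma integrable_bounded_support (D : set T) (f : T -> R) M :
  measurable D -> (m D < +oo)%E -> measurable_fun setT f ->
  (forall x, ~ D x -> f x = 0) -> (forall x, D x -> `|f x| <= M) ->
  m.-integrable setT (EFin \o f).
Proof.
move=> mD Dfin mf f0 fM.
have ig : m.-integrable setT (fun x => (`|M|%:E * (EFin \o \1_D) x)%E).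
  apply: integrableZl => //; apply/integrableP; split.
    by apply/measurable_EFinP; exact: measurable_indic.
  under eq_integral do rewrite /= ger0_norm//.
  by rewrite integral_indic// setIT.
apply: le_integrable ig => //; first exact/measurable_EFinP.
move=> x _ /=; rewrite lee_fin indicE.
have [/set_mem Dx|/negP nDx] := boolP (x \in D).
  rewrite mulr1 normr_id; apply: le_trans (fM _ Dx) (ler_norm _).
by rewrite f0 ?normr0// => /mem_set.
Qed.

End bounded_support.

Section affine_substitution.
Variables (t c : R).
Hypothesis t0 : 0 < t.

Let phi (x : measurableTypeR R) : measurableTypeR R := t * x + c.

Let mphi : measurable_fun setT phi.
Proof.
by apply: measurable_funD => //; exact: measurable_funM.
Qed.

(** The push-forward under x -> t x + c of t times Lebesgue measure agrees with Lebesgue measure on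
    half-open intervals, hence on all measurable sets. *)
Lemma ge0_integral_affine (f : R -> \bar R) :
  measurable_fun setT f -> (forall x, (0 <= f x)%E) ->
  (\int[mu]_x f x = t%:E * \int[mu]_x f (t * x + c)%R)%E.
Proof.
move=> mf f0.
pose k := NngNum (ltW t0).
pose nu : {measure set (measurableTypeR R) -> \bar R} :=
  measure_function_pushforward__canonical__measure_function_Measure
    (mscale k mu) mphi.
have muE A : measurable A -> mu A = nu A.
  move=> mA; apply: (@lebesgue_measure_unique _ nu _ _ mA).
  move=> _ [[a b] _ <-] /=; rewrite /pushforward /mscale /=.
  have -> : phi @^-1` `]a, b] = `](a - c) / t, (b - c) / t]%classic.
    apply/seteqP; split=> x /=; rewrite !in_itv /= /phi.
      rewrite ltr_pdivrMr// ler_pdivlMr// (mulrC x) => /andP[? ?].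
      by apply/andP; split; lra.
    rewrite ltr_pdivrMr// ler_pdivlMr// (mulrC x) => /andP[? ?].
    by apply/andP; split; lra.
  rewrite !lebesgue_measure_itv /= !lte_fin ltr_pM2r ?invr_gt0// ltrD2r.
  case: ifP => _; last by rewrite mule0.
  rewrite -!EFinB -EFinM; congr EFin; field.
  by rewrite gt_eqF.
rewrite (eq_measure_integral nu); last first.
  by move=> A mA _; exact: muE.
rewrite ge0_integral_pushforward// preimage_setT ge0_integral_mscale//.
  exact: measurableT_comp.
by move=> x _; exact: f0.
Qed.

Lemma integral_affine (f : R -> R) :
  mu.-integrable setT (EFin \o f) ->
  mu.-integrable setT (EFin \o (fun x => f (t * x + c))) /\
  (\int[mu]_x (f x)%:E = t%:E * \int[mu]_x (f (t * x + c)%R)%:E)%E.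
Proof.
move=> intf; have mf : measurable_fun setT f.
  by apply/measurable_EFinP; exact: measurable_int intf.
have mfp : measurable_fun setT (fun x => f (t * x + c)).
  exact: measurableT_comp.
have intg : mu.-integrable setT (EFin \o (fun x => f (t * x + c))).
  apply/integrableP; split; first exact/measurable_EFinP.
  have /integrableP[_] := intf.
  rewrite ge0_integral_affine//=; last first.
    by do 2 apply: measurableT_comp => //; exact/measurable_EFinP.
  apply: contraTT; rewrite -!leNgt !leye_eq => /eqP ->.
  by rewrite gt0_muley ?lte_fin.
split=> //; set g := fun x => f (t * x + c).
pose I1 := (\int[mu]_x (EFin \o g)^\+ x)%E.
pose I2 := (\int[mu]_x (EFin \o g)^\- x)%E.
have I12 : (I1 +? - I2)%E := integrable_add_def measurableT intg.
have -> : (\int[mu]_x (g x)%:E = I1 - I2)%E by exact: integralE.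
rewrite (muleBr _ I12)// integralE.
have mfE : measurable_fun setT (EFin \o f) by exact/measurable_EFinP.
rewrite (@ge0_integral_affine ((EFin \o f)^\+)%E)//; last exact: measurable_funepos.
rewrite (@ge0_integral_affine ((EFin \o f)^\-)%E)//; last exact: measurable_funeneg.
by congr (_ * _ - _ * _)%E; apply: eq_integral => x _; rewrite ?funeposE ?funenegE.
Qed.

End affine_substitution.

End measure_tools.

Section real_valued_integrable.
Context {R : realType} d (T : measurableType d) (m : {measure set T -> \bar R}).
Variables f g : T -> R.
Hypothesis mif : m.-integrable setT (EFin \o f).
Hypothesis mig : m.-integrable setT (EFin \o g).

Lemma integrable_mulr (k : R) : m.-integrable setT (EFin \o (fun x => k * f x)).
Proof. exact: (eq_integrable measurableT _ _ _ (integrableZl measurableT k mif)). Qed.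

Lemma integrable_addr : m.-integrable setT (EFin \o (fun x => f x + g x)).
Proof. exact: (eq_integrable measurableT _ _ _ (integrableD measurableT mif mig)). Qed.

Lemma integrable_subr : m.-integrable setT (EFin \o (fun x => f x - g x)).
Proof. exact: (eq_integrable measurableT _ _ _ (integrableB measurableT mif mig)). Qed.

End real_valued_integrable.

(** * Integration by parts through difference quotients *)

Section one_dimensional.
Context {R : realType}.
Local Notation mu := (@lebesgue_measure R).

Lemma integral_derive_eq0 (G g : R -> R) (a b : R) : a < b ->
  (forall x, is_derive x (1 : R) G (g x)) -> continuous g ->
  (forall x, x <= a \/ b <= x -> G x = 0 /\ g x = 0) ->
  (\int[mu]_x (g x)%:E = 0)%E.
Proof.
move=> ab dG cg out.
have cG : continuous G.
  by move=> x; apply/differentiable_continuous/derivable1_diffP; case: (dG x).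
have -> : (\int[mu]_x (g x)%:E = \int[mu]_(x in `[a, b]) (g x)%:E)%E.
  rewrite [RHS]integral_mkcond; apply: eq_integral => x _; rewrite patchE.
  case: ifPn => // /negP xab; rewrite (out x _).2//.
  have [|ax] := leP x a; [by left|right].
  by rewrite leNgt; apply/negP => xb; apply: xab; rewrite inE /= in_itv /= !ltW.
rewrite (@continuous_FTC2 _ g G)//.
- by rewrite (out a _).1 ?(out b _).1 ?subee//; [right|left].
- exact: continuous_subspaceT.
- split=> [x _||]; first by case: (dG x).
    by apply: cvg_at_right_filter; exact: cG.
  by apply: cvg_at_left_filter; exact: cG.
- by move=> x _; rewrite derive1E; case: (dG x).
Qed.

(** Derivatives become limits along the steps 1 / (n + 1), as dominated convergence requires a
    sequence. *)
Lemma harmonic_dnbhs : @harmonic R n @[n --> \oo] --> (0 : R)^'.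
Proof.
move=> P /= [e /= e0 he].
have := @cvg_harmonic R => /cvgrPdist_lt/(_ e e0); apply: filterS => n hn.
by apply: he => //=; rewrite gt_eqF// harmonic_gt0.
Qed.

Section difference_quotient.
Variables (f f' : R -> R) (X C : R).
Hypothesis df : forall x, is_derive x (1 : R) f (f' x).
Hypothesis cf' : continuous f'.
Hypothesis f0 : forall x, X < `|x| -> f x = 0.
Hypothesis f'0 : forall x, X < `|x| -> f' x = 0.
Hypothesis f'C : forall x, `|f' x| <= C.

Let cf : continuous f.
Proof.
by move=> x; apply/differentiable_continuous/derivable1_diffP; case: (df x).
Qed.

Let D (n : nat) x := (f (x + harmonic n) - f x) / harmonic n.

Let D_cvg x : D n x @[n --> \oo] --> f' x.
Proof.
have [dfx dE] := df x.
have h : (h^-1 *: ((f \o shift x) (h *: (1 : R)) - f x)) @[h --> (0:R)^'] --> f' x.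
  by rewrite -dE; exact: dfx.
have := cvg_comp _ _ harmonic_dnbhs h; apply: cvg_trans.
apply: near_eq_cvg; near=> n; rewrite /D /= /shift /= [RHS]mulrC.
by congr (_ * (f _ - _)); rewrite addrC; congr (_ + _); exact: mulr1.
Unshelve. all: by end_near. Qed.

Let harmonic_le1 n : @harmonic R n <= 1.
Proof. by rewrite /= invf_le1 ?ltr0n// ler1n. Qed.

Let D_le n x : `|D n x| <= C.
Proof.
have h0 : 0 < @harmonic R n := harmonic_gt0 n.
have lt : x < x + harmonic n by rewrite ltrDl.
have [c _ e] := MVT lt (fun y _ => df y) (continuous_subspaceT cf).
by rewrite /D e addrAC subrr add0r mulfK ?gt_eqF.
Qed.

(** The steps are at most 1, so all difference quotients are supported in [-(X + 1), X + 1]; this is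
    the origin of X + 1 in the bounds below. *)
Let D_out n x : X + 1 < `|x| -> D n x = 0.
Proof.
move=> hx; rewrite /D !f0 ?subrr ?mul0r//; first lra.
have := ler_normB (x + harmonic n) (harmonic n); rewrite addrK.
have := harmonic_le1 n; have := harmonic_gt0 (R := R) n => h0 h1.
by rewrite (gtr0_norm h0); lra.
Qed.

Let measD n : measurable_fun setT (D n).
Proof.
have mf := continuous_measurable_fun cf.
apply: measurable_funM => //; apply: measurable_funB => //.
by apply: measurableT_comp => //; exact: measurable_funD.
Qed.

Let mf' : measurable_fun setT f' := continuous_measurable_fun cf'.

Let I : set R := `[- (X + 1), X + 1].

Let I_fin : (mu I < +oo)%E.
Proof.
by rewrite /I lebesgue_measure_itv /=; case: ifP => _; rewrite ?ltry.
Qed.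

Let notI x : ~ I x -> X + 1 < `|x|.
Proof.
move=> nI; rewrite ltNge; apply/negP => h; apply: nI.
by rewrite /I /= in_itv /= -ler_norml.
Qed.

Let inI x : I x -> `|x| <= X + 1.
Proof. by rewrite /I /= in_itv /= -ler_norml. Qed.

Lemma integrable_bump (g : R -> R) M : measurable_fun setT g ->
  (forall x, X + 1 < `|x| -> g x = 0) ->
  (forall x, `|x| <= X + 1 -> `|g x| <= M) -> mu.-integrable setT (EFin \o g).
Proof.
move=> mg g0 gM; apply: (@integrable_bounded_support R _ (measurableTypeR R) mu I g M).
- exact: measurable_itv.
- exact: I_fin.
- exact: mg.
- by move=> x nx; apply: g0; exact: notI.
- by move=> x Ix; apply: gM; exact: inI.
Qed.

Lemma difference_quotient_integral_cvg (w : R -> R) M : measurable_fun setT w ->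
  (forall x, `|x| <= X + 1 -> `|w x| <= M) ->
  (\int[mu]_x (w x * ((f (x + harmonic n) - f x) / harmonic n)))
    @[n --> \oo] --> \int[mu]_x (w x * f' x).
Proof.
move=> mw wM.
have C0 : 0 <= C := le_trans (normr_ge0 _) (f'C 0).
have [|||||intf _ h] := @dominated_convergence _ _ _ mu setT measurableT
  (fun n x => (w x * D n x)%:E) (fun x => (w x * f' x)%:E)
  (fun x => (`|M| * C * \1_I x)%:E).
- move=> n; apply/measurable_EFinP. apply: measurable_funM => //; exact: measD.
- by apply/measurable_EFinP; exact: measurable_funM.
- apply: aeW => x _; apply: cvg_EFin; first exact: nearW.
  by apply: cvgM; [exact: cvg_cst|exact: D_cvg].
- apply: (@integrable_bump _ (`|M| * C)).
  + by apply: measurable_funM => //; apply: measurable_indic; exact: measurable_itv.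
  + move=> x hx; rewrite indicE memNset ?mulr0//.
    by move=> /inI; rewrite leNgt hx.
  + move=> x _; rewrite indicE; case: (_ \in _); rewrite ?mulr1 ?mulr0 ?normr0.
      by rewrite ger0_norm// mulr_ge0.
    by rewrite mulr_ge0.
- apply: aeW => x n _ /=; rewrite lee_fin normrM indicE.
  have [/set_mem/inI hx|] := boolP (x \in I).
    rewrite mulr1 ler_pM//; apply: le_trans (wM _ hx) (ler_norm _).
  move=> /negP nI; rewrite D_out ?normr0 ?mulr0//.
  by apply: notI => /mem_set.
have fin := integrable_fin_num measurableT intf.
by apply: fine_cvg; rewrite fineK.
Qed.

Section balance.
Variables (w u e : R -> R) (s M C' : R).
Hypothesis f_ge0 : forall x, 0 <= f x.
Hypothesis fC : forall x, `|f x| <= C'.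
Hypothesis mw : measurable_fun setT w.
Hypothesis meas_u : measurable_fun setT u.
Hypothesis me : measurable_fun setT e.
Hypothesis wM : forall x, `|x| <= X + 1 -> `|w x| <= M.
Hypothesis uM : forall x, `|x| <= X + 1 -> `|u x| <= M.
Hypothesis eM : forall x, `|x| <= X + 1 -> `|e x| <= M.
(** A finite-difference form of w' <= - s * e that tolerates jumps of w. The increment of u is an
    error term, which disappears with h after integration against f. *)
Hypothesis balance : forall x h, 0 < h ->
  w x - w (x - h) <= h * s * (2 * (u x - u (x - h)) - e x).

Let mf := continuous_measurable_fun cf.

Let int_mul (g : R -> R) (c : R) : measurable_fun setT g ->
  (forall x, `|x| <= X + 1 -> `|g x| <= M) -> 0 <= c <= 1 ->
  mu.-integrable setT (EFin \o (fun x => g x * f (x + c))).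
Proof.
move=> mg gM /andP[c0 c1]; apply: (@integrable_bump _ (M * C')).
- apply: measurable_funM => //; apply: measurableT_comp => //.
  exact: measurable_funD.
- move=> x hx; rewrite f0 ?mulr0//.
  have := ler_normB (x + c) c; rewrite addrK (ger0_norm c0); lra.
- by move=> x hx; rewrite normrM ler_pM// gM.
Qed.

(** Discrete integration by parts: translation invariance moves the difference from the smooth f to
    the possibly discontinuous g. *)
Let shift_quotient (g : R -> R) n : measurable_fun setT g ->
  (forall x, `|x| <= X + 1 -> `|g x| <= M) ->
  mu.-integrable setT
    (EFin \o (fun x => (g (x - harmonic n) - g x) / harmonic n * f x)) /\
  \int[mu]_x (g x * ((f (x + harmonic n) - f x) / harmonic n)) =
  \int[mu]_x ((g (x - harmonic n) - g x) / harmonic n * f x).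
Proof.
move=> mg gM; set h := harmonic n.
have h0 : 0 < h := harmonic_gt0 n.
have i0 := @int_mul g 0 mg gM; rewrite lexx ler01 in i0; have {}i0 := i0 isT.
have i1 := @int_mul g h mg gM; rewrite (ltW h0) harmonic_le1 in i1; have {}i1 := i1 isT.
have [i2 e2] := @integral_affine R 1 (- h) ltr01 _ i1.
rewrite mul1e in e2.
have {}i0 : mu.-integrable setT (EFin \o (fun x => g x * f x)).
  by apply: eq_integrable i0 => // x _ /=; rewrite addr0.
have {}i2 : mu.-integrable setT (EFin \o (fun x => g (x - h) * f x)).
  by apply: eq_integrable i2 => // x _ /=; rewrite mul1r subrK.
have {}e2 : \int[mu]_x (g x * f (x + h)) = \int[mu]_x (g (x - h) * f x).
  rewrite /Rintegral e2; congr fine; apply: eq_integral => x _.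
  by rewrite mul1r subrK.
have i3 : mu.-integrable setT
    (EFin \o (fun x => h^-1 * (g (x - h) * f x - g x * f x))).
  by apply: integrable_mulr; exact: integrable_subr.
split; first by apply: eq_integrable i3 => // x _ /=; congr EFin; ring.
transitivity (\int[mu]_x (h^-1 * (g x * f (x + h) - g x * f x))).
  by apply: eq_Rintegral => x _; ring.
transitivity (\int[mu]_x (h^-1 * (g (x - h) * f x - g x * f x))); last first.
  by apply: eq_Rintegral => x _; ring.
rewrite !RintegralZl//; [|exact: integrable_subr|exact: integrable_subr].
by rewrite !RintegralB// e2.
Qed.

(** The difference quotient of f is moved to w, where [balance] applies pointwise because f >= 0.
    The error is the step h times a convergent integral, so it vanishes in the limit. *)
Lemma integral_entropy_balance_ge0 :
  0 <= \int[mu]_x (w x * f' x - s * (e x * f x)).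
Proof.
have ief : mu.-integrable setT (EFin \o (fun x => e x * f x)).
  have := @int_mul e 0 me eM; rewrite lexx ler01 => /(_ isT).
  by apply: eq_integrable => // x _ /=; rewrite addr0.
have iwf : mu.-integrable setT (EFin \o (fun x => w x * f' x)).
  apply: (@integrable_bump _ (M * C)).
  - exact: measurable_funM.
  - by move=> x hx; rewrite f'0 ?mulr0//; lra.
  - by move=> x hx; rewrite normrM ler_pM// wM.
rewrite RintegralB//; last exact: integrable_mulr.
rewrite RintegralZl// subr_ge0.
have cw := difference_quotient_integral_cvg mw wM.
have cu := difference_quotient_integral_cvg meas_u uM.
pose I_ (n : nat) := s * \int[mu]_x (e x * f x) + 2 * s * (harmonic n *
  \int[mu]_x (u x * ((f (x + harmonic n) - f x) / harmonic n))).
have cI : I_ n @[n --> \oo] --> s * \int[mu]_x (e x * f x).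
  rewrite -[X in _ --> X]addr0; apply: cvgD; first exact: cvg_cst.
  rewrite -(mulr0 (2 * s)); apply: cvgM; first exact: cvg_cst.
  rewrite -(mul0r (\int[mu]_x (u x * f' x))).
  by apply: cvgM => //; exact: cvg_harmonic.
apply: (ler_cvg_to cI cw); apply: nearW => n; rewrite /I_.
have [iw ->] := shift_quotient n mw wM.
have [iu ->] := shift_quotient n meas_u uM.
rewrite mulrA -!RintegralZl// -RintegralD//; last 2 first.
  exact: integrable_mulr.
  exact: integrable_mulr.
apply: le_Rintegral => //.
  by apply: integrable_addr; exact: integrable_mulr.
move=> x _; set h := harmonic n.
have h0 : 0 < h := harmonic_gt0 n.
have -> : s * (e x * f x) + 2 * s * h * ((u (x - h) - u x) / h * f x) =
    (h * s * (e x - 2 * (u x - u (x - h)))) / h * f x.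
  by field; rewrite gt_eqF.
by rewrite ler_wpM2r// ler_pM2r ?invr_gt0//; have := balance x h0; lra.
Qed.

End balance.
End difference_quotient.

End one_dimensional.

(** * Self-similar functions and Kruzhkov's inequalities *)

Section test_functions.
Context {R : realType}.
Implicit Types (phi : R * R -> R) (Om : set (R * R)).

Lemma is_derive_line phi (gam : R -> R * R) (v : R * R) (s : R) :
  (forall h, gam (h + s) = h *: v + gam s) -> differentiable phi (gam s) ->
  is_derive s (1 : R) (phi \o gam) ('D_v phi (gam s)).
Proof.
move=> hgam dphi.
have E : (fun h : R =>
      h^-1 *: (((phi \o gam) \o shift s) (h *: (1 : R)) - (phi \o gam) s))
    = (fun h : R => h^-1 *: ((phi \o shift (gam s)) (h *: v) - phi (gam s))).
  apply/funext => h /=; congr (_ *: (phi _ - _)); rewrite -hgam.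
  by congr (gam (_ + _)); exact: mulr1.
have dv := @diff_derivable _ _ _ phi (gam s) v dphi.
by apply: DeriveDef; rewrite /derivable /derive E.
Qed.

Lemma continuous_bounded_on (T : topologicalType) (f : T -> R) (S : set T) :
  continuous f -> compact S -> exists C, forall z, S z -> `|f z| <= C.
Proof.
move=> cf cS; have [->|/set0P S0] := eqVneq S set0; first by exists 0.
have cnf : {within S, continuous (fun z => `|f z|)}.
  by apply: continuous_subspaceT => z; apply: cvg_norm; exact: cf.
have [c _ hc] := compact_EVT_max S0 cS cnf.
by exists `|f c| => z Sz; apply: hc; rewrite inE.
Qed.

Lemma test_function_out Om phi : test_function Om phi ->
  forall z, ~ closure [set z | phi z != 0] z ->
  [/\ phi z = 0, partial_t phi z = 0 & partial_x phi z = 0].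
Proof.
move=> [_ _ _ _] z nSz.
have near0 : \near z, phi z = cst 0 z.
  have oS : open (~` closure [set z | phi z != 0]).
    exact/closed_openC/closed_closure.
  apply: filterS (open_nbhs_nbhs (conj oS nSz)) => y /= nSy.
  apply/eqP; apply: contra_notT nSy => h.
  exact: subset_closure.
have d0 v : 'D_v phi z = 0 by rewrite (near_eq_derive _ near0) derive_cst.
split; [exact: (nbhs_singleton near0)|exact: d0|exact: d0].
Qed.

(** A compact support inside t > 0 stays at a positive distance t0 from t = 0, where x / t is
    singular. *)
Lemma test_function_bounds Om phi : test_function Om phi ->
  (forall z, Om z -> 0 < z.1) ->
  exists t0 t1 X C, [/\ 0 < t0, t0 < t1, 0 <= X,
    forall z, ~ (t0 <= z.1 <= t1 /\ `|z.2| <= X) ->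
      [/\ phi z = 0, partial_t phi z = 0 & partial_x phi z = 0]
  & forall z, [/\ `|phi z| <= C, `|partial_t phi z| <= C
                & `|partial_x phi z| <= C]].
Proof.
move=> tphi Om0; have out := test_function_out tphi.
have [[dphi ct cx] cS SOm _] := tphi.
set S := closure _ in out cS SOm.
have cphi : continuous phi by move=> z; exact: differentiable_continuous.
have [C1 h1] := continuous_bounded_on cphi cS.
have [C2 h2] := continuous_bounded_on ct cS.
have [C3 h3] := continuous_bounded_on cx cS.
have cfst : continuous (@fst R R) by move=> z; exact: cvg_fst.
have csnd : continuous (@snd R R) by move=> z; exact: cvg_snd.
have [T1 hT1] := continuous_bounded_on cfst cS.
have [X hX] := continuous_bounded_on csnd cS.
have [t0 t00 ht0] : exists2 t0, 0 < t0 & forall z, S z -> t0 <= z.1.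
  have [S0|/set0P S0] := eqVneq S set0; first by exists 1 => // z; rewrite S0.
  have [c Sc hc] := compact_EVT_min S0 cS (continuous_subspaceT cfst).
  by rewrite inE in Sc; exists c.1 => [|z Sz]; [exact/Om0/SOm|apply: hc; rewrite inE].
(* The last summand of t1 makes t0 < t1 strict, even for an empty support. *)
exists t0, (t0 + `|T1| + 1), `|X|, (`|C1| + `|C2| + `|C3|).
have T10 := normr_ge0 T1.
split=> // [|z nz|z]; first lra.
- apply: out => Sz; apply: nz; split; last exact: le_trans (hX _ Sz) (ler_norm _).
  rewrite ht0//=; have := hT1 z Sz; have := ler_norm z.1; have := ler_norm T1; lra.
- have [C10 C20 C30] := And3 (normr_ge0 C1) (normr_ge0 C2) (normr_ge0 C3).
  have [Sz|/out[-> -> ->]] := pselect (S z); last by rewrite normr0; split; lra.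
  have := h1 z Sz; have := h2 z Sz; have := h3 z Sz.
  have := ler_norm C1; have := ler_norm C2; have := ler_norm C3.
  by move=> *; split; lra.
Qed.

End test_functions.

Section self_similar.
Context {R : realType}.
Local Notation mu := (@lebesgue_measure R).
Local Notation mu2 := (mu \x mu)%E.
Variables (H V : R -> R) (k L N : R).

Let eta (xi : R) : R := `|V xi - k|.
Let psi (xi : R) : R := entropy_flux H (V xi) k.
Let W (xi : R) : R := psi xi - xi * eta xi.

Hypothesis L0 : 0 <= L.
Hypothesis hH : forall x y, `|H x - H y| <= L * `|x - y|.
Hypothesis mV : {homo V : x y / x <= y}.
Hypothesis VN : forall xi, eta xi <= N.
(** Finite-difference form of W' <= - eta, meaningful where V jumps; the increment of V is the error
    term that [integral_entropy_balance_ge0] removes. *)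
Hypothesis entropic : forall x y, x < y ->
  W y - W x <= (y - x) * (2 * (V y - V x) - eta y).

Let N0 : 0 <= N. Proof. exact: le_trans (normr_ge0 _) (VN 0). Qed.

Let measV : measurable_fun setT V.
Proof. by apply: nondecreasing_measurable => //; exact: mV. Qed.

Let meas_eta : measurable_fun setT eta.
Proof. by apply: measurableT_comp => //; exact: measurable_funB. Qed.

Let meas_sg : measurable_fun setT (@Num.sg R).
Proof.
by apply: nondecreasing_measurable => // x y xy; case: sgrP; case: sgrP; lra.
Qed.

Let meas_psi : measurable_fun setT psi.
Proof.
apply: measurable_funM; first by apply: measurableT_comp => //; exact: measurable_funB.
apply: measurable_funB => //; apply: measurableT_comp => //.
apply: continuous_measurable_fun; exact: lip_continuous hH.
Qed.

Let meas_W : measurable_fun setT W.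
Proof. by apply: measurable_funB => //; exact: measurable_funM. Qed.

Let psi_le xi : `|psi xi| <= L * N.
Proof.
rewrite /psi /entropy_flux normrM -[leRHS]mul1r ler_pM//.
  by rewrite normr_sg; case: (_ != _) => //=.
by apply: le_trans (hH _ _) _; rewrite ler_wpM2l// VN.
Qed.

Let W_le (xi Y : R) : `|xi| <= Y -> `|W xi| <= (L + Y) * N.
Proof.
move=> xiY; rewrite /W mulrDl (le_trans (ler_normB _ _))// lerD//.
by rewrite normrM normr_id ler_pM// VN.
Qed.

Section test_function.
Variables (Om : set (R * R)) (phi : R * R -> R) (t0 t1 X C : R).
Hypothesis tphi : test_function Om phi.
Hypothesis t00 : 0 < t0.
Hypothesis t01 : t0 < t1.
Hypothesis X0 : 0 <= X.
Hypothesis out : forall z, ~ (t0 <= z.1 <= t1 /\ `|z.2| <= X) ->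
  [/\ phi z = 0, partial_t phi z = 0 & partial_x phi z = 0].
Hypothesis bnd : forall z, [/\ `|phi z| <= C, `|partial_t phi z| <= C
                & `|partial_x phi z| <= C].

Let C0 : 0 <= C. Proof. by case: (bnd 0) => h _ _; exact: le_trans h. Qed.

Let dphi z : differentiable phi z. Proof. by case: tphi => -[]. Qed.
Let cpt : continuous (partial_t phi). Proof. by case: tphi => -[]. Qed.
Let cpx : continuous (partial_x phi). Proof. by case: tphi => -[]. Qed.
Let cphi : continuous phi. Proof. by move=> z; exact: differentiable_continuous. Qed.
Let phi_ge0 z : 0 <= phi z. Proof. by case: tphi. Qed.

(** The splitting eta phi_t + psi phi_x = A + B: A is exact in t after x = t xi, and B has a
    nonnegative integral over each time slice. *)
Let A (z : R * R) := eta (z.2 / z.1) *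
  (partial_t phi z + z.2 / z.1 * partial_x phi z + phi z / z.1).
Let B (z : R * R) := W (z.2 / z.1) * partial_x phi z
  - z.1^-1 * (eta (z.2 / z.1) * phi z).

Let A_out z : ~ (t0 <= z.1 <= t1 /\ `|z.2| <= X) -> A z = 0.
Proof. by move=> /out[h1 h2 h3]; rewrite /A h1 h2 h3 !(mulr0, mul0r, addr0). Qed.

Let B_out z : ~ (t0 <= z.1 <= t1 /\ `|z.2| <= X) -> B z = 0.
Proof. by move=> /out[h1 h2 h3]; rewrite /B h1 h3 !(mulr0, subr0). Qed.

Let inv_le (t : R) : t0 <= t -> `|t^-1| <= t0^-1.
Proof.
move=> ht; have t_gt0 : 0 < t := lt_le_trans t00 ht.
have h : t^-1 <= t0^-1 by rewrite lef_pV2 ?posrE.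
by rewrite ger0_norm; [exact: h|rewrite invr_ge0 ltW].
Qed.

Let xi_le z : t0 <= z.1 <= t1 /\ `|z.2| <= X -> `|z.2 / z.1| <= X / t0.
Proof. by move=> [/andP[h _] hX]; rewrite normrM ler_pM// inv_le. Qed.

Let A_le z : t0 <= z.1 <= t1 /\ `|z.2| <= X ->
  `|A z| <= N * (C + X / t0 * C + C / t0).
Proof.
move=> hz; have [h1 h2 h3] := bnd z; rewrite /A normrM ler_pM//.
  by rewrite normr_id VN.
rewrite (le_trans (ler_normD _ _))// lerD//.
  by rewrite (le_trans (ler_normD _ _))// lerD// normrM ler_pM// xi_le.
by rewrite normrM ler_pM// inv_le//; case: hz => /andP[].
Qed.

Let B_le z : t0 <= z.1 <= t1 /\ `|z.2| <= X ->
  `|B z| <= (L + X / t0) * N * C + t0^-1 * (N * C).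
Proof.
move=> hz; have [h1 h2 h3] := bnd z; rewrite /B (le_trans (ler_normB _ _))// lerD//.
  by rewrite normrM ler_pM// W_le// xi_le.
rewrite normrM ler_pM//; first by rewrite inv_le//; case: hz => /andP[].
by rewrite normrM ler_pM// normr_id VN.
Qed.

Let meas_xi : measurable_fun setT (fun z : R * R => z.2 / z.1).
Proof.
apply: measurable_funM; first exact: measurable_snd.
by apply: (measurableT_comp measurable_invr); exact: measurable_fst.
Qed.

Let meas_inv1 : measurable_fun setT (fun z : R * R => z.1^-1).
Proof. by apply: (measurableT_comp measurable_invr); exact: measurable_fst. Qed.

Let mphi := continuous_measurable_prod cphi.
Let mpt := continuous_measurable_prod cpt.
Let mpx := continuous_measurable_prod cpx.

Let measA : measurable_fun setT A.
Proof.
apply: measurable_funM; first exact: (measurableT_comp meas_eta meas_xi).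
apply: measurable_funD; last exact: measurable_funM.
by apply: measurable_funD => //; exact: measurable_funM.
Qed.

Let measB : measurable_fun setT B.
Proof.
apply: measurable_funB.
  by apply: measurable_funM => //; exact: (measurableT_comp meas_W meas_xi).
apply: measurable_funM => //; apply: measurable_funM => //.
exact: (measurableT_comp meas_eta meas_xi).
Qed.

Let integrable_box (f : R * R -> R) (a b Y M : R) : measurable_fun setT f ->
  (forall z, ~ (a <= z.1 <= b /\ `|z.2| <= Y) -> f z = 0) ->
  (forall z, a <= z.1 <= b /\ `|z.2| <= Y -> `|f z| <= M) ->
  mu2.-integrable setT (EFin \o f).
Proof.
move=> mf f0 fM.
have boxE z : (`[a, b] `*` `[- Y, Y]) z <-> a <= z.1 <= b /\ `|z.2| <= Y.
  by case: z => x y; rewrite /setX /= !in_itv /= ler_norml.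
apply: (@integrable_bounded_support R _ (measurableTypeR R * measurableTypeR R)%type
  mu2 (`[a, b] `*` `[- Y, Y]) f M).
- by apply: measurableX; exact: measurable_itv.
- pose I1 : set (measurableTypeR R) := `[a, b]%classic.
  pose I2 : set (measurableTypeR R) := `[- Y, Y]%classic.
  suff h : (mu I1 * mu I2 < +oo)%E.
    apply: le_lt_trans h; rewrite le_eqVlt; apply/orP; left; apply/eqP.
    by apply: product_measure1E; exact: measurable_itv.
  by rewrite !lebesgue_measure_itv /=; case: ifP; case: ifP => *;
    rewrite -?EFinB -?EFinM ?mule0 ?mul0e ltry.
- exact: mf.
- by move=> z nz; apply: f0 => hz; apply: nz; apply/boxE.
- by move=> z /boxE; exact: fM.
Qed.

Let intA : mu2.-integrable setT (EFin \o A).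
Proof. exact: integrable_box measA A_out A_le. Qed.

Let intB : mu2.-integrable setT (EFin \o B).
Proof. exact: integrable_box measB B_out B_le. Qed.

Let integrable_slice (f : R -> R) (Y M : R) : measurable_fun setT f ->
  (forall x, ~ `|x| <= Y -> f x = 0) ->
  (forall x, `|x| <= Y -> `|f x| <= M) -> mu.-integrable setT (EFin \o f).
Proof.
move=> mf f0 fM.
pose I : set R := `[- Y, Y]%classic.
have boxE x : I x <-> `|x| <= Y by rewrite /I /= in_itv /= ler_norml.
have I_fin : (mu I < +oo)%E.
  by rewrite /I lebesgue_measure_itv /=; case: ifP => _; rewrite ltry.
apply: (@integrable_bounded_support R _ (measurableTypeR R) mu I f M).
- exact: measurable_itv.
- exact: I_fin.
- exact: mf.
- by move=> z nz; apply: f0 => hz; apply: nz; apply/boxE.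
- by move=> z /boxE; exact: fM.
Qed.

Let slice_le0 (t : R) : t <= 0 ->
  forall x : R, ~ (t0 <= (t, x).1 <= t1 /\ `|(t, x).2| <= X).
Proof.
by move=> ht x [/andP[/= h _] _]; have := le_lt_trans ht t00; rewrite ltNge h.
Qed.

Let B_slice_ge0 (t : R) : (0 <= \int[mu]_x (B (t, x))%:E)%E.
Proof.
have [t_gt0|ht] := ltP 0 t; last first.
  rewrite integral0_eq// => x _; rewrite B_out//; exact: slice_le0.
have int : mu.-integrable setT (EFin \o (fun x : R => B (t, x))).
  have [hb|hb] := boolP (t0 <= t <= t1).
    apply: (@integrable_slice _ X ((L + X / t0) * N * C + t0^-1 * (N * C))).
    - exact: measurable_fun_pair2.
    - by move=> x nx; apply: B_out => -[_ /= ?].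
    - by move=> x hx; apply: B_le.
  apply: (@integrable_slice _ 0 0) => [|x _|x _].
  - exact: measurable_fun_pair2.
  - by apply: B_out => -[/= h _]; rewrite h in hb.
  - by rewrite B_out ?normr0// => -[/= h _]; rewrite h in hb.
rewrite -(fineK (integrable_fin_num measurableT int)) lee_fin.
have dx (x : R) : is_derive x (1 : R) (fun x : R => phi (t, x)) (partial_x phi (t, x)).
  apply: (@is_derive_line _ phi (fun x : R => (t, x)) (0, 1) x) => // h.
  rewrite -[RHS]/(h *: 0 + t, h *: 1 + x) scaler0 add0r.
  by congr (_, _ + _); rewrite -[LHS]mulr1.
have cx : continuous (fun x : R => partial_x phi (t, x)).
  move=> x; apply: (@continuous_comp _ _ _ (fun x : R => (t, x)) (partial_x phi)).
    exact: (cvg_pair (cvg_cst t) cvg_id).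
  exact: cpx.
have mdiv (f : R -> R) : measurable_fun setT f ->
    measurable_fun setT (fun x : R => f (x / t)).
  by move=> mf; apply: (measurableT_comp mf); exact: measurable_funM.
have xt (x : R) : `|x| <= X + 1 -> `|x / t| <= (X + 1) / t.
  move=> hx; have ti : 0 <= t^-1 by rewrite invr_ge0 ltW.
  by rewrite normrM (ger0_norm ti); apply: ler_wpM2r.
have Xt : 0 <= (X + 1) / t by rewrite divr_ge0 ?addr_ge0// ltW.
(* At time t the scale is s = 1 / t: a step h in x is a step h / t in xi. The sum passed as common
   bound dominates W, V and eta simultaneously. *)
apply: (@integral_entropy_balance_ge0 _ (fun x : R => phi (t, x))
  (fun x : R => partial_x phi (t, x)) X C dx cx _ _ _ (fun x : R => W (x / t))
  (fun x : R => V (x / t)) (fun x : R => eta (x / t))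
  t^-1 ((L + (X + 1) / t) * N + N + `|k|) C).
- by move=> x hx; case: (@out (t, x)) => // -[_ /=]; lra.
- by move=> x hx; case: (@out (t, x)) => // -[_ /=]; lra.
- by move=> x; case: (bnd (t, x)).
- by [].
- by move=> x; case: (bnd (t, x)).
- exact: mdiv.
- exact: mdiv.
- exact: mdiv.
- move=> x hx; have := N0; have := W_le (xt x hx); have := normr_ge0 k; lra.
- move=> x hx; have := VN (x / t); rewrite /eta.
  have := ler_normB (V (x / t) - k) (- k); rewrite opprK subrK normrN.
  have : 0 <= (L + (X + 1) / t) * N by rewrite mulr_ge0// addr_ge0.
  have := N0; lra.
- move=> x hx; have := VN (x / t); rewrite /eta normr_id.
  have : 0 <= (L + (X + 1) / t) * N by rewrite mulr_ge0// addr_ge0.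
  have := N0; have := normr_ge0 k; lra.
- move=> x h h0; have := @entropic ((x - h) / t) (x / t).
  rewrite ltr_pM2r ?invr_gt0// gtrDl oppr_lt0 => /(_ h0).
  by rewrite (_ : x / t - (x - h) / t = h / t)//; ring.
Qed.

Let int_B_ge0 : (0 <= \int[mu2]_z (B z)%:E)%E.
Proof.
rewrite -(integral12_prod_meas1 intB).
by apply: integral_ge0 => t _; exact: B_slice_ge0.
Qed.

(** For t > 0 this is t * A (t, t xi), Jacobian included. Multiplying out phi / t leaves a factor of
    eta that is continuous on the whole plane. *)
Let g (z : R * R) := eta z.2 * (z.1 * (partial_t phi (z.1, z.1 * z.2)
  + z.2 * partial_x phi (z.1, z.1 * z.2)) + phi (z.1, z.1 * z.2)).

Let g_out (z : R * R) : ~ (t0 <= z.1 <= t1 /\ `|z.2| <= X / t0) -> g z = 0.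
Proof.
move=> hz; have [h1 h2 h3] : [/\ phi (z.1, z.1 * z.2) = 0,
    partial_t phi (z.1, z.1 * z.2) = 0 & partial_x phi (z.1, z.1 * z.2) = 0].
  apply: out => -[/= h hX]; apply: hz; split=> //.
  have /andP[ht _] := h; have z0 : 0 < z.1 := lt_le_trans t00 ht.
  rewrite ler_pdivlMr//; apply: le_trans hX; rewrite normrM mulrC ler_wpM2r//.
  by rewrite (le_trans ht)// ler_norm.
by rewrite /g h1 h2 h3 !(mulr0, addr0).
Qed.

Let g_le (z : R * R) : t0 <= z.1 <= t1 /\ `|z.2| <= X / t0 ->
  `|g z| <= N * (t1 * (C + X / t0 * C) + C).
Proof.
move=> [/andP[h1 h2] hX].
have [b1 b2 b3] := bnd (z.1, z.1 * z.2).
have z0 : 0 < z.1 := lt_le_trans t00 h1.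
rewrite /g normrM ler_pM//; first by rewrite normr_id VN.
rewrite (le_trans (ler_normD _ _))// lerD// normrM ler_pM//.
  by rewrite gtr0_norm.
by rewrite (le_trans (ler_normD _ _))// lerD// normrM ler_pM.
Qed.

Let cline : continuous (fun z : R * R => (z.1, z.1 * z.2)).
Proof.
have cm : continuous (fun z : R * R => z.1 * z.2).
  by move=> y; apply: cvgM; [exact: cvg_fst|exact: cvg_snd].
by move=> z; exact: (cvg_pair cvg_fst (cm z)).
Qed.

Let c_comp (f : R * R -> R) : continuous f ->
  continuous (fun z : R * R => f (z.1, z.1 * z.2)).
Proof. by move=> cf z; apply: continuous_comp; [exact: cline|exact: cf]. Qed.

Let c_inner : continuous (fun z : R * R => z.1 * (partial_t phi (z.1, z.1 * z.2)
  + z.2 * partial_x phi (z.1, z.1 * z.2)) + phi (z.1, z.1 * z.2)).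
Proof.
move=> z; apply: cvgD; last exact: (c_comp cphi).
apply: cvgM; first exact: cvg_fst.
apply: cvgD; first exact: (c_comp cpt).
by apply: cvgM; [exact: cvg_snd|exact: (c_comp cpx)].
Qed.

Let measg : measurable_fun setT g.
Proof.
apply: measurable_funM; first exact: (measurableT_comp meas_eta measurable_snd).
exact: (continuous_measurable_prod c_inner).
Qed.

Let intg : mu2.-integrable setT (EFin \o g).
Proof. exact: integrable_box measg g_out g_le. Qed.

Let A_slice (t : R) : (\int[mu]_x (A (t, x))%:E = \int[mu]_xi (g (t, xi))%:E)%E.
Proof.
have [t_gt0|ht] := ltP 0 t; last first.
  rewrite !integral0_eq// => x _; first by rewrite g_out// => -[/andP[/= h _] _];
    have := le_lt_trans ht t00; rewrite ltNge h.
  by rewrite A_out//; exact: slice_le0.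
have int : mu.-integrable setT (EFin \o (fun x : R => A (t, x))).
  have mA : measurable_fun setT (fun x : R => A (t, x)).
    exact: measurable_fun_pair2.
  have [hb|hb] := boolP (t0 <= t <= t1).
    apply: (@integrable_slice _ X (N * (C + X / t0 * C + C / t0))) => //.
      by move=> x nx; apply: A_out => -[_ /= ?].
    by move=> x hx; apply: A_le.
  apply: (@integrable_slice _ 0 0) => // x _.
    by apply: A_out => -[/= h _]; rewrite h in hb.
  by rewrite A_out ?normr0// => -[/= h _]; rewrite h in hb.
have [int' ->] := @integral_affine R t 0 t_gt0 _ int.
rewrite -integralZl//; apply: eq_integral => x _; rewrite -EFinM; congr EFin.
have t_neq0 : t != 0 by rewrite gt_eqF.
by rewrite /A /g /= addr0 (mulrC t x) mulfK//; field.
Qed.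

(** For fixed xi, eta xi is a constant, whatever the regularity of V, and g is the t-derivative of
    the compactly supported function G. *)
Let g_slice_eq0 (xi : R) : (\int[mu]_t (g (t, xi))%:E = 0)%E.
Proof.
pose G (t : R) := eta xi * (t * phi (t, t * xi)).
(* These bounds enclose [t0, t1] strictly, so G and g already vanish at both of them. *)
have t0h : t0 / 2 < t1 + 1 by have := t00; have := t01; lra.
apply: (@integral_derive_eq0 _ G (fun t : R => g (t, xi)) (t0 / 2) (t1 + 1) t0h).
- move=> t.
  have dl : is_derive t (1 : R) (fun s : R => phi (s, s * xi))
      ('D_(1, xi) phi (t, t * xi)).
    apply: (@is_derive_line _ phi (fun s : R => (s, s * xi)) (1, xi) t) => // h.
    rewrite -[RHS]/(h *: 1 + t, h *: xi + t * xi).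
    by congr (_ + _, _); rewrite ?mulrDl// -[LHS]mulr1.
  have -> : g (t, xi) = eta xi *: (t *: 'D_(1, xi) phi (t, t * xi)
      + phi (t, t * xi) *: (1 : R)).
    rewrite /g /= /partial_t /partial_x; congr (_ * (_ * _ + _));
      last by rewrite -[LHS]mulr1.
    rewrite !deriveE//.
    have -> : ((1, xi) : R * R) = (1, 0) + xi *: (0, 1).
      by rewrite -[RHS]/(1 + xi *: 0, 0 + xi *: 1) scaler0 addr0 add0r -[xi in LHS]mulr1.
    by rewrite linearD linearZ.
  have dm := is_deriveM (is_derive_id t (1 : R)) dl.
  exact: (is_deriveZ (eta xi) dm).
- move=> t; apply: (cvgM (cvg_cst (eta xi))).
  apply: (@continuous_comp _ _ _ (fun t : R => (t, xi)) (fun z : R * R =>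
    z.1 * (partial_t phi (z.1, z.1 * z.2)
    + z.2 * partial_x phi (z.1, z.1 * z.2)) + phi (z.1, z.1 * z.2))).
    exact: (cvg_pair cvg_id (cvg_cst xi)).
  exact: c_inner.
- move=> t ht; have nt : ~ t0 <= t <= t1.
    by move=> h; have := t00; case: ht => ?; lra.
  have [/= h _ _] := @out (t, t * xi) (fun h => nt h.1).
  split; first by rewrite /G h !mulr0.
  by apply: g_out => -[/= /nt].
Qed.

(** Fubini in x, the substitution x = t xi on each slice, then Fubini for g in the other order,
    integrating first in t. *)
Let int_A_eq0 : (\int[mu2]_z (A z)%:E = 0)%E.
Proof.
rewrite -(integral12_prod_meas1 intA).
transitivity (\int[mu]_t fubini_F mu (EFin \o g) t)%E.
  by apply: eq_integral => t _; exact: A_slice.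
rewrite (integral12_prod_meas1 intg) -(integral21_prod_meas1 intg).
by apply: integral0_eq => xi _; exact: g_slice_eq0.
Qed.

Lemma self_similar_test_ge0 : (0 <= \int[mu2]_z
  (`|V (z.2 / z.1) - k| * partial_t phi z
   + entropy_flux H (V (z.2 / z.1)) k * partial_x phi z)%:E)%E.
Proof.
have -> : (\int[mu2]_z (`|V (z.2 / z.1) - k| * partial_t phi z
    + entropy_flux H (V (z.2 / z.1)) k * partial_x phi z)%:E =
    \int[mu2]_z ((A z)%:E + (B z)%:E))%E.
  apply: eq_integral => z _; rewrite -EFinD; congr EFin.
  by rewrite /A /B /W /eta /psi; ring.
by rewrite integralD// int_A_eq0 add0e int_B_ge0.
Qed.

End test_function.

Lemma self_similar_kruzhkov_ge0 (Om : set (R * R)) (phi : R * R -> R)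
    (v : R * R -> R) :
  test_function Om phi -> (forall z, Om z -> 0 < z.1) ->
  (forall z, Om z -> v z = V (z.2 / z.1)) ->
  (0 <= \int[mu2]_(z in Om) (`|v z - k| * partial_t phi z
       + entropy_flux H (v z) k * partial_x phi z)%:E)%E.
Proof.
move=> tphi Om0 vV.
have [t0 [t1 [X [C [t00 t01 X0 out bnd]]]]] := test_function_bounds tphi Om0.
have := self_similar_test_ge0 tphi t00 t01 X0 out bnd.
rewrite [X in _ -> (0 <= X)%E]integral_mkcond.
congr (0 <= _)%E; apply: eq_integral => z _; rewrite patchE.
(* Outside Om the derivatives of phi vanish, so the values of v there do not matter. *)
case: ifPn => [/set_mem Oz|/negP nz]; first by rewrite vV.
have [|_ -> ->] := test_function_out tphi (z := z).
  by move=> Sz; apply: nz; apply/mem_set; case: tphi => _ _ + _; apply.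
by rewrite !mulr0 addr0.
Qed.

End self_similar.

(** * Riemann problems *)

Section fans.
Context {R : realType}.
Implicit Types (H V : R -> R).

(* The solution of the Riemann problem from a to b is V (x / t); for smooth
   convex H the minimality of V xi reads H^` (V xi) = xi. *)
Definition fan H (a b : R) V := forall xi, a <= V xi <= b /\
  forall q, a <= q <= b -> H (V xi) - xi * V xi <= H q - xi * q.

(** Any choice of minimizers will do: monotonicity, and with it measurability, follows from
    minimality alone. *)
Lemma fan_exists H (a b : R) : continuous H -> a <= b -> exists V, fan H a b V.
Proof.
move=> cH ab; suff /choice[V hV] : forall xi, exists v, a <= v <= b /\
    forall q, a <= q <= b -> H v - xi * v <= H q - xi * q by exists V.
move=> xi; have cf : {within `[a, b], continuous (fun q => H q - xi * q)}.
  apply: continuous_subspaceT => q; apply: cvgB; first exact: cH.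
  by apply: cvgM; [exact: cvg_cst|exact: cvg_id].
have [c + hc] := EVT_min ab cf; rewrite in_itv /= => cab.
by exists c; split=> // q qab; apply: hc; rewrite in_itv.
Qed.

Lemma entropy_flux_ge H (u k : R) : k <= u -> entropy_flux H u k = H u - H k.
Proof.
rewrite /entropy_flux le_eqVlt => /predU1P[->|ku]; first by rewrite !subrr mulr0.
by rewrite gtr0_sg ?subr_gt0// mul1r.
Qed.

Lemma entropy_flux_le H (u k : R) : u <= k -> entropy_flux H u k = H k - H u.
Proof.
rewrite /entropy_flux le_eqVlt => /predU1P[->|ku]; first by rewrite !subrr mulr0.
by rewrite ltr0_sg ?subr_lt0// mulN1r opprB.
Qed.

Section fan_properties.
Variables (H V : R -> R) (a b L : R).
Hypothesis hH : forall x y, `|H x - H y| <= L * `|x - y|.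
Hypothesis ab : a <= b.
Hypothesis fV : fan H a b V.

Let step x y : H (V x) - x * V x <= H (V y) - x * V y.
Proof. by have [_ h] := fV x; apply: h; case: (fV y). Qed.

(** Adding the minimality at x with competitor V y to the one at y with competitor V x gives (y - x)
    (V x - V y) <= 0. *)
Lemma fan_nondecreasing : {homo V : x y / x <= y}.
Proof.
move=> x y; rewrite le_eqVlt => /predU1P[->//|xy].
have h1 := step x y; have h2 := step y x.
rewrite leNgt; apply/negP => lt.
have : 0 < (y - x) * (V x - V y) by rewrite mulr_gt0 ?subr_gt0.
lra.
Qed.

Lemma fan_bounded k xi : `|V xi - k| <= `|a| + `|b| + `|k|.
Proof.
have [/andP[h1 h2] _] := fV xi.
rewrite (le_trans (ler_normB _ _))// lerD2r ler_norml.
have := ler_norm b; have := ler_norm (- a); rewrite normrN.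
have := normr_ge0 a; have := normr_ge0 b.
by move=> *; apply/andP; split; lra.
Qed.

(* The quantity differenced here is
   sg (V xi - k) * ((H (V xi) - xi * V xi) - (H k - xi * k)). Where V crosses
   the level k it jumps down because k is a competitor in the minimum. *)
Lemma fan_entropic k x y : x < y ->
  (entropy_flux H (V y) k - y * `|V y - k|)
  - (entropy_flux H (V x) k - x * `|V x - k|)
  <= (y - x) * (2 * (V y - V x) - `|V y - k|).
Proof.
move=> xy; have mxy := fan_nondecreasing (ltW xy).
have h1 := step x y; have h2 := step y x.
have dxy : 0 < y - x by rewrite subr_gt0.
have pos u v : v <= u -> 0 <= (y - x) * (u - v).
  by rewrite -subr_ge0 => ?; rewrite mulr_ge0// ltW.
have p1 := pos _ _ mxy.
have [kx|/ltW xk] := leP k (V x).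
  have ky := le_trans kx mxy.
  rewrite !entropy_flux_ge// !ger0_norm ?subr_ge0//; lra.
have [ky|/ltW yk] := leP k (V y).
  rewrite entropy_flux_ge// entropy_flux_le//.
  rewrite (ger0_norm (x := V y - k)) ?subr_ge0// (ler0_norm (x := V x - k)) ?subr_le0//.
  have [/andP[ax _] hx] := fV x; have [/andP[_ yb] hy] := fV y.
  have kab : a <= k <= b by lra.
  have := hx k kab; have := hy k kab; have := pos _ _ xk; lra.
rewrite !entropy_flux_le// !ler0_norm ?subr_le0//; lra.
Qed.

(** Finite speed of propagation: below -L the function q -> H q - xi q is strictly increasing, so
    its minimum is at a. *)
Lemma fan_left xi : xi < - L -> V xi = a.
Proof.
move=> xiL; have [/andP[av _] h] := fV xi.
have := h a; rewrite lexx ab => /(_ isT) ha.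
apply/le_anti; rewrite av andbT leNgt; apply/negP => lt.
have [h1 _] := lip_incr hH (ltW lt).
have : 0 < (- L - xi) * (V xi - a) by rewrite mulr_gt0// subr_gt0.
lra.
Qed.

Lemma fan_right xi : L < xi -> V xi = b.
Proof.
move=> xiL; have [/andP[_ vb] h] := fV xi.
have := h b; rewrite lexx ab => /(_ isT) hb.
apply/le_anti; rewrite vb /= leNgt; apply/negP => lt.
have [_ h1] := lip_incr hH (ltW lt).
have : 0 < (xi - L) * (b - V xi) by rewrite mulr_gt0// subr_gt0.
lra.
Qed.

(** A first hit at b means H > H b on [a, b). By compactness H exceeds H b by a fixed margin on
    [a, b - e], and for xi near 0 the term xi q cannot compensate it. *)
Lemma fan_trace_left : first_hit H a b ->
  forall e, 0 < e -> exists2 d, 0 < d &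
    forall xi, - d < xi < 0 -> `|V xi - b| <= e.
Proof.
move=> [hit _] e e0; have cH := lip_continuous hH.
have [be|be] := leP (b - a) e.
  exists 1 => // xi _; have [/andP[h1 h2] _] := fV xi.
  by rewrite ler0_norm ?subr_le0//; lra.
have abe : a <= b - e by lra.
have [c cab [_ hc]] := godunov_minP cH abe.
have Hc : H b < H c by apply: hit; lra.
(* The margin divided by the largest possible difference of states. *)
exists ((H c - H b) / (b - a)); first by rewrite divr_gt0 ?subr_gt0//; lra.
move=> xi /andP[xi1 xi0]; have [/andP[h1 h2] h] := fV xi.
rewrite ler0_norm ?subr_le0// opprB lerBlDl -lerBlDr leNgt; apply/negP => lt.
have h3 : H c <= H (V xi) by apply: hc; rewrite h1 ltW.
have := h b; rewrite lexx ab => /(_ isT) h4.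
have d0 : 0 < b - a by lra.
have : - xi * (b - a) < H c - H b by rewrite -ltr_pdivlMr// ltrNl.
have : 0 <= - xi * (V xi - a) by rewrite mulr_ge0 ?subr_ge0//; lra.
lra.
Qed.

End fan_properties.

Lemma fan_reflect H V a b : fan H a b V ->
  fan (fun x => H (- x)) (- b) (- a) (fun xi => - V (- xi)).
Proof.
move=> fV xi; have [h1 h2] := fV (- xi); split; first by rewrite !lerN2 andbC.
move=> q hq; rewrite opprK; have := h2 (- q); rewrite !mulNr !mulrN !opprK.
by apply; lra.
Qed.

(** Changing the sign of the unknown turns the maximization needed for a > b into a minimization. *)
Lemma reflect_kruzhkov H (Om : set (R * R)) (v : R * R -> R) :
  kruzhkov_solution (fun x => - H (- x)) Om (fun z => - v z) ->
  kruzhkov_solution H Om v.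
Proof.
move=> h k phi tphi; have := h (- k) phi tphi.
congr (0 <= _)%E; apply: eq_integral => z _; congr ((_ * _ + _ * _)%:E).
  by rewrite -opprD normrN.
by rewrite /entropy_flux !opprK [- v z + k]addrC -opprB sgrN mulNr -mulrN opprD opprK.
Qed.

(* The solution V (x / t) of the Riemann problem from a to b; a state is
   attained at xi = 0 when no other extremum of H precedes it. *)
Definition riemann_profile H (L a b : R) V (M : R) :=
  [/\ measurable_fun setT V /\ (forall xi, `|V xi| <= M),
    (forall xi, xi < - L -> V xi = a) /\ (forall xi, L < xi -> V xi = b),
    first_hit H a b -> forall e, 0 < e -> exists2 d, 0 < d &
      forall xi, - d < xi < 0 -> `|V xi - b| <= e,
    first_hit (fun x => H (- x)) (- b) (- a) -> forall e, 0 < e ->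
      exists2 d, 0 < d & forall xi, 0 < xi < d -> `|V xi - a| <= e
  & forall Om v, (forall z : R * R, Om z -> 0 < z.1) ->
      (forall z, Om z -> v z = V (z.2 / z.1)) -> kruzhkov_solution H Om v].

Lemma riemann_profile_exists H (L a b : R) : 0 <= L ->
  (forall x y, `|H x - H y| <= L * `|x - y|) ->
  exists V M, riemann_profile H L a b V M.
Proof.
move=> L0.
have main H' a' b' : a' <= b' ->
  (forall x y, `|H' x - H' y| <= L * `|x - y|) ->
  exists V M, riemann_profile H' L a' b' V M.
  move=> ab hH; have [V fV] := fan_exists (lip_continuous hH) ab.
  have mV := fan_nondecreasing fV.
  exists V, (`|a'| + `|b'| + `|0 : R|); split.
  - split; first exact: nondecreasing_measurable.
    by move=> xi; have := fan_bounded fV 0 xi; rewrite subr0.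
  - by split; [exact: fan_left hH ab fV|exact: fan_right hH ab fV].
  - exact: fan_trace_left hH ab fV.
  - move=> hit e e0; have ab' : - b' <= - a' by rewrite lerN2.
    have [d d0 hd] := fan_trace_left (reflect_lip hH) ab' (fan_reflect fV) hit e0.
    exists d => // xi xid; have := hd (- xi); rewrite opprK -opprD normrN.
    by apply; lra.
  - move=> Om v Om0 vV k phi tphi.
    exact: (self_similar_kruzhkov_ge0 L0 hH mV (fan_bounded fV k)
      (@fan_entropic _ _ _ _ fV k) tphi Om0 vV).
(* For b < a the profile is minus the fan of -H(-q) from -a to -b, so it maximizes H q - xi q over
   [b, a]. *)
move=> hH; have [ab|/ltW ba] := leP a b; first exact: main.
have hH' x y : `|(- H (- x)) - (- H (- y))| <= L * `|x - y|.
  by rewrite -opprD normrN; exact: (reflect_lip hH).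
have ba' : - a <= - b by rewrite lerN2.
have [V [M [[mV VM] [Vl Vr] tl tr kz]]] := main _ _ _ ba' hH'.
exists (fun xi => - V xi), M; split.
- split; last by move=> xi; rewrite normrN.
  exact: measurableT_comp.
- by split=> xi hxi; [rewrite Vl ?opprK|rewrite Vr ?opprK].
- move=> /first_hitN /tl h e /h[d d0 hd]; exists d => // xi /hd.
  by rewrite -normrN opprD !opprK.
- move=> /first_hitN.
  rewrite -[X in first_hit X _ _]/(fun x => - H (- - x)) => /tr h e /h[d d0 hd].
  by exists d => // xi /hd; rewrite -normrN opprD !opprK.
- move=> Om v Om0 vV; apply: reflect_kruzhkov; apply: kz => // z Oz.
  by rewrite vV// opprK.
Qed.

End fans.

(** * Gluing two Riemann profiles at x = 0 *)

Section riemann_solutions.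
Context {R : realType}.
Local Notation mu := (@lebesgue_measure R).

(** The exceptional null set can be empty, since the estimates for the self-similar solution hold at
    every point near the limit. *)
Lemma ess_cvg0 (f : R -> \bar R) (F : set_system R) : Filter F ->
  (forall x, 0 <= f x)%E ->
  (forall e : R, 0 < e -> \forall x \near F, (f x <= e%:E)%E) ->
  ess_cvg f F 0%E.
Proof.
move=> FF f0 fe; exists set0; first exact: negligible_set0.
have near_within (P : set R) : F P -> within (~` set0) F P.
  by rewrite /within; apply: filterS => x Px _.
apply/fine_cvgP; split.
  apply: near_within; apply: filterS (fe 1 ltr01) => x fx.
  by rewrite ge0_fin_numE// (le_lt_trans fx)// ltry.
apply/cvgrPdist_le => e e0; apply: near_within.
apply: filterS (fe e e0) => x fx /=.
rewrite sub0r normrN ger0_norm ?fine_ge0// -lee_fin fineK//.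
by rewrite ge0_fin_numE// (le_lt_trans fx)// ltry.
Qed.

Lemma L1_dist_ge0 (D : set R) (f g : R -> R) : (0 <= L1_dist D f g)%E.
Proof. by apply: integral_ge0 => x _; rewrite lee_fin. Qed.

(** I collects the points without a small bound: short times for the traces, the cone |x| <= L t for
    the initial data. *)
Lemma L1_dist_le (D I : set R) (f g : R -> R) (M e : R) :
  measurable D -> measurable I -> measurable_fun D (fun x => f x - g x) ->
  0 <= M -> 0 <= e ->
  (forall x, D x -> `|f x - g x| <= M) ->
  (forall x, D x -> ~ I x -> `|f x - g x| <= e) ->
  (L1_dist D f g <= M%:E * mu I + e%:E * mu D)%E.
Proof.
move=> mD mI mfg M0 e0 fM fe.
have mI1 : measurable_fun D (fun x => (M * \1_I x)%:E).
  by apply/measurable_EFinP; apply: measurable_funM => //; exact: measurable_indic.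
apply: (@le_trans _ _ (\int[mu]_(x in D) ((M * \1_I x)%:E + e%:E))%E).
  apply: ge0_le_integral => //.
  - by apply/measurable_EFinP; apply: measurableT_comp.
  - by apply: emeasurable_funD => //; exact/measurable_EFinP.
  - move=> x Dx; rewrite -EFinD lee_fin indicE.
    have [_|/negP nI] := boolP (x \in I).
      by rewrite mulr1 (le_trans (fM _ Dx))// lerDl.
    rewrite mulr0 add0r; apply: fe => // Ix; apply: nI; exact/mem_set.
rewrite ge0_integralD//; last by move=> x _; rewrite lee_fin mulr_ge0.
rewrite integral_cst// leeD2r//.
under eq_integral do rewrite EFinM.
rewrite ge0_integralZl//; last first.
  by apply/measurable_EFinP; exact: measurable_indic.
by rewrite integral_indic// lee_wpmul2l ?lee_fin// le_measure ?inE//; exact: measurableI.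
Qed.

Section solution.
Variables (HL HR : R -> R) (G : set (R * R)) (vm vp qL qR LL LR ML MR : R).
Variables (VL VR : R -> R).
Hypothesis Gq : G (qL, qR).
Hypothesis LL0 : 0 <= LL.
Hypothesis hitL : first_hit HL vm qL.
Hypothesis hitR : first_hit (fun x => HR (- x)) (- vp) (- qR).
Hypothesis pL : riemann_profile HL LL vm qL VL ML.
Hypothesis pR : riemann_profile HR LR qR vp VR MR.

(** The left profile joins vm to qL and the right one qR to vp; the first-hit hypotheses make qL and
    qR their traces at x = 0. *)
Let v (z : R * R) : R := if z.2 < 0 then VL (z.2 / z.1) else VR (z.2 / z.1).

Let mVL : measurable_fun setT VL. Proof. by case: pL => -[]. Qed.
Let mVR : measurable_fun setT VR. Proof. by case: pR => -[]. Qed.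

Let M := Num.max ML MR.

Let vM z : `|v z| <= M.
Proof.
have [[_ hL] _ _ _ _] := pL; have [[_ hR] _ _ _ _] := pR.
rewrite /v /M; case: ifP => _; [apply: le_trans (hL _) _|apply: le_trans (hR _) _];
  by rewrite le_max lexx ?orbT.
Qed.

Let M0 : 0 <= M. Proof. exact: le_trans (normr_ge0 _) (vM 0). Qed.

Let mv : measurable_fun setT v.
Proof.
have mq : measurable_fun setT (fun z : R * R => z.2 / z.1).
  apply: measurable_funM; first exact: measurable_snd.
  by apply: (measurableT_comp measurable_invr); exact: measurable_fst.
apply: measurable_fun_ifT;
  [|exact: (measurableT_comp mVL mq)|exact: (measurableT_comp mVR mq)].
by apply: measurable_fun_ltr => //; exact: measurable_snd.
Qed.

Let mv1 (t : R) : measurable_fun setT (fun x => v (t, x)).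
Proof. exact: measurable_fun_pair2. Qed.

Let mv2 (x : R) : measurable_fun setT (fun t => v (t, x)).
Proof. exact: measurable_fun_pair1. Qed.

(* Times t <= d contribute at most (M + |q|) * d to the L1 distance. *)
Let trace_cvg (T q : R) (F : set_system R) : Filter F -> 0 < T ->
  (forall e, 0 < e -> forall d, 0 < d -> \forall x \near F,
    forall t, d < t -> `|v (t, x) - q| <= e) ->
  strong_trace T v F (cst q).
Proof.
move=> FF T0 h; split.
  have muD : mu (`]0, T[%classic : set R) = T%:E.
    by rewrite lebesgue_measure_itv /= lte_fin T0 -EFinB subr0.
  apply/integrableP; split; first exact/measurable_EFinP.
  rewrite /= integral_cst//.
  by have := ltry (`|q| * T); rewrite EFinM -muD.
apply: ess_cvg0 => [x|e e0]; first exact: L1_dist_ge0.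
pose K := M + `|q|.
have K0 : 0 <= K by rewrite addr_ge0.
(* Short times and the remaining times each receive e / 2; K + 1 keeps the denominator positive when
   K = 0. *)
have d0 : 0 < e / (2 * (K + 1)) by rewrite divr_gt0// mulr_gt0// ltr_wpDl.
have e'0 : 0 < e / (2 * T) by rewrite divr_gt0// mulr_gt0.
apply: filterS (h _ e'0 _ d0) => x hx.
set d := e / (2 * (K + 1)) in d0 hx; set e' := e / (2 * T) in e'0 hx.
have := @L1_dist_le `]0, T[%classic `[0, d]%classic (fun t => v (t, x)) (cst q) K e'
  (measurable_itv _) (measurable_itv _).
move=> /(_ _ K0 (ltW e'0)) H; apply: le_trans (H _ _ _) _.
- by apply: measurable_funTS; apply: measurable_funB.
- by move=> t _; rewrite (le_trans (ler_normB _ _))// lerD.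
- move=> t; rewrite /= !in_itv /= => /andP[t0 _] /negP; rewrite negb_and -!ltNge.
  by move=> /orP[|dt]; [rewrite ltNge (ltW t0)|exact: hx].
rewrite !lebesgue_measure_itv /= !lte_fin d0 T0 -!EFinB !subr0 -!EFinM -EFinD lee_fin.
have -> : e' * T = e / 2 by rewrite /e'; field; rewrite gt_eqF.
have : K * d <= e / 2.
  rewrite /d mulrA ler_pdivrMr ?mulr_gt0 ?ltr_wpDl//.
  have : 0 <= K * e by rewrite mulr_ge0// ltW.
  lra.
lra.
Qed.

Lemma riemann_entropy_solution :
  entropy_solution HL HR G (riemann_data vm vp) v.
Proof.
have [_ [Ll Lr] tL _ kL] := pL; have [_ [Rl Rr] _ tR kR] := pR.
move=> T T0; split.
- split; first exact: measurable_funTS.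
  by exists M; apply: aeW => z _; exact: vM.
- exists (cst qL), (cst qR); split.
  + apply: trace_cvg => // e e0 d d0.
    have [s s0 hs] := tL hitL e e0.
    have : \forall x \near (0 : R)^'-, x < 0 by exact: nbhs_left_lt.
    have : \forall x \near (0 : R)^'-, - (s * d) < x.
      by apply: nbhs_left_gt; rewrite oppr_lt0 mulr_gt0.
    apply: filterS2 => x xs x0 t dt; rewrite /v /= x0; apply: hs.
    have t0 := lt_trans d0 dt.
    rewrite ltr_pdivlMr// mulNr pmulr_llt0 ?invr_gt0// x0 andbT.
    by apply: lt_trans xs; rewrite ltrN2 ltr_pM2l.
  + apply: trace_cvg => // e e0 d d0.
    have [s s0 hs] := tR hitR e e0.
    have : \forall x \near (0 : R)^'+, 0 < x by exact: nbhs_right_gt.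
    have : \forall x \near (0 : R)^'+, x < s * d.
      by apply: nbhs_right_lt; rewrite mulr_gt0.
    apply: filterS2 => x xs x0 t dt; rewrite /v /= ltNge (ltW x0) /=; apply: hs.
    have t0 := lt_trans d0 dt.
    rewrite divr_gt0//= ltr_pdivrMr//.
    by apply: lt_trans xs _; rewrite ltr_pM2l.
  + by apply: aeW => t _.
- apply: kL => -[t x] [/= + +]; rewrite !in_itv /= => /andP[t0 _] x0 //.
  by rewrite /v /= x0.
- apply: kR => -[t x] [/= + +]; rewrite !in_itv /= ?andbT => /andP[t0 _] x0 //.
  by rewrite /v /= ltNge (ltW x0).
- move=> A; apply: ess_cvg0 => [t|e e0]; first exact: L1_dist_ge0.
  pose L := Num.max LL LR; pose K := M + (`|vm| + `|vp|).
  have L0 : 0 <= L by rewrite le_max LL0.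
  have K0 : 0 <= K by rewrite !addr_ge0.
  (* The cone has width 2 L t and contributes at most 2 K L t, which is below e for such t; the
     added 1 covers K L = 0. *)
  have c0 : 0 < e / (2 * (K * L) + 1).
    by rewrite divr_gt0// ltr_wpDl// !mulr_ge0.
  have : \forall t \near (0 : R)^'+, 0 < t by exact: nbhs_right_gt.
  have : \forall t \near (0 : R)^'+, t < e / (2 * (K * L) + 1).
    exact: nbhs_right_lt.
  apply: filterS2 => t te t0.
  have mr : measurable_fun setT (riemann_data vm vp).
    by apply: measurable_fun_ifT => //; apply: measurable_fun_ltr.
  have Lt : 0 <= L * t by rewrite mulr_ge0// ltW.
  have := @L1_dist_le `[- A, A]%classic `[- (L * t), L * t]%classic
    (fun x => v (t, x)) (riemann_data vm vp) K 0 (measurable_itv _) (measurable_itv _).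
  move=> /(_ _ K0 (lexx 0)) H; apply: le_trans (H _ _ _) _.
  + by apply: measurable_funTS; apply: measurable_funB.
  + move=> x _; rewrite (le_trans (ler_normB _ _))// lerD//.
    by rewrite /riemann_data; case: ifP; rewrite ?lerDl ?lerDr.
  + move=> x _ /=; rewrite in_itv /= => /negP; rewrite negb_and -!ltNge /v /riemann_data /=.
    have LL_L : LL * t <= L * t by rewrite ler_pM2r// le_max lexx.
    have LR_L : LR * t <= L * t by rewrite ler_pM2r// le_max lexx orbT.
    (* Outside the cone x / t exceeds the speed bounds, so each profile equals its Riemann datum
       exactly. *)
    move=> /orP[h|h].
      have x0 : x < 0 by lra.
      by rewrite x0 Ll ?subrr ?normr0// ltr_pdivrMr// mulNr; lra.
    have x0 : 0 <= x by lra.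
    by rewrite ltNge x0 /= Rr ?subrr ?normr0// ltr_pdivlMr//; lra.
  rewrite mul0e adde0 lebesgue_measure_itv /= lte_fin.
  case: ifP => _; last by rewrite mule0 lee_fin ltW.
  rewrite -EFinB -EFinM lee_fin opprK.
  have : t * (2 * (K * L) + 1) < e by rewrite -ltr_pdivlMr// ltr_wpDl// !mulr_ge0.
  lra.
Qed.

End solution.
End riemann_solutions.

Theorem theorem1p8 (R : realType) (HL HR : R -> R) (G : set (R * R)) :
  assumption_H HL -> assumption_H HR -> germ HL HR G ->
  ((exists F0 : R * R -> R,
      assumption_F F0 /\ G = flux_germ HL HR (relax HL HR F0))
   <-> (maximal_germ HL HR G /\ complete_germ HL HR G)).
Proof.
move=> hL hR gG; split=> [[F [hF ->]]|[mG _]]; last exact: maximal_germ_relax.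
have mG := maximal_flux_germ_relax hL hR hF; split=> //.
split=> [|vm vp]; first by case: mG.
have [/lipschitzP[LL LL0 lL] _ _] := hL.
have [/lipschitzP[LR LR0 lR] _ _] := hR.
have [[qL qR] [Gq _ hitL hitR]] := relax_riemann_traces (vm, vp) hL hR hF.
have [VL [ML pL]] := riemann_profile_exists vm qL LL0 lL.
have [VR [MR pR]] := riemann_profile_exists qR vp LR0 lR.
by eexists; exact: (riemann_entropy_solution Gq LL0 hitL hitR pL pR).
Qed.
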